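(* Let $H$ be a cocommutative nonlocal vertex bialgebra and let $V$ be a nonlocal vertex algebra. Suppose that $(V,Y_V^H)$ is an $H$-module nonlocal vertex algebra and $(V,\rho)$ is a right $H$-comodule nonlocal vertex algebra such that $Y_V^H$ and $\rho$ are compatible. For $a\in V$, set $$\mathfrak D_{Y_V^H}^\rho (Y)(a,x)=\sum Y(a_{(1)},x)Y_V^H(a_{(2)},x)$$ on $V$, where $\rho(a)=\sum a_{(1)}\otimes a_{(2)}\in V\otimes H$. Then $(V,\mathfrak D_{Y_V^H}^\rho (Y),\mathbf 1)$ carries the structure of a nonlocal vertex algebra; denote it by $\mathfrak D_{Y_V^H}^\rho (V)$. Furthermore, $\rho$ is a nonlocal vertex algebra homomorphism from $\mathfrak D_{Y_V^H}^\rho (V)$ to the smash product $V\sharp H$.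
   Context: All vector spaces are over $\mathbb C$; $W((x_1,x_2))=W[[x_1,x_2]][x_1^{-1},x_2^{-1}]$; powers $(x\pm z)^n$ are expanded in nonnegative powers of the second variable. A nonlocal vertex algebra is a vector space $V$ with a linear map $Y(\cdot,x):V\to(\mathrm{End}\,V)[[x,x^{-1}]]$, $Y(v,x)=\sum_{n\in\mathbb Z}v_nx^{-n-1}$, and a vector $\mathbf 1\in V$ such that $Y(u,x)v\in V((x))$; $Y(\mathbf 1,x)v=v$, $Y(v,x)\mathbf 1\in V[[x]]$ with $\lim_{x\to0}Y(v,x)\mathbf 1=v$; and for any $u,v\in V$ there is $k\ge 0$ with $(x_1-x_2)^kY(u,x_1)Y(v,x_2)\in \mathrm{Hom}(V,V((x_1,x_2)))$ and $\big((x_1-x_2)^kY(u,x_1)Y(v,x_2)\big)|_{x_1=x_2+x_0}=x_0^kY(Y(u,x_0)v,x_2)$. Homomorphisms are linear maps $f$ with $f(\mathbf 1)=\mathbf 1$, $f(Y(u,x)v)=Y(f(u),x)f(v)$. The tensor product has $Y(u\otimes a,x)(v\otimes b)=Y(u,x)v\otimes Y(a,x)b$. A module for $V$ is a vector space $W$ with a linear map $Y_W(\cdot,x):V\to \mathrm{Hom}(W,W((x)))$ such that $Y_W(\mathbf 1,x)=1_W$ and for $u,v\in V$ there is $k\ge0$ with $(x_1-x_2)^kY_W(u,x_1)Y_W(v,x_2)\in \mathrm{Hom}(W,W((x_1,x_2)))$ and $\big((x_1-x_2)^kY_W(u,x_1)Y_W(v,x_2)\big)|_{x_1=x_2+x_0}=x_0^kY_W(Y(u,x_0)v,x_2)$.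 A nonlocal vertex bialgebra is a nonlocal vertex algebra $H$ with a (classical) coalgebra structure $(\Delta,\varepsilon)$ such that $\Delta:H\to H\otimes H$ and $\varepsilon:H\to\mathbb C$ are homomorphisms of nonlocal vertex algebras. It is cocommutative if the coalgebra is. Sweedler notation: $\Delta(h)=\sum h_{(1)}\otimes h_{(2)}$. An $H$-module nonlocal vertex algebra is a nonlocal vertex algebra $V$ with a module structure $Y_V^H(\cdot,x)$ on $V$ for $H$ viewed as a nonlocal vertex algebra such that for $h\in H$, $u,v\in V$: $Y_V^H(h,x)v\in V\otimes\mathbb C((x))$; $Y_V^H(h,x)\mathbf 1=\varepsilon(h)\mathbf 1$; $Y_V^H(h,x_1)Y(u,x_2)v=\sum Y(Y_V^H(h_{(1)},x_1-x_2)u,x_2)Y_V^H(h_{(2)},x_1)v$. The smash product $V\sharp H$ is the nonlocal vertex algebra with underlying space $V\otimes H$, vacuum $\mathbf 1\otimes\mathbf 1$, and $Y^\sharp(u\otimes h,x)(v\otimes h')=\sum Y(u,x)Y_V^H(h_{(1)},x)v\otimes Y(h_{(2)},x)h'$. A right $H$-comodule nonlocal vertex algebra is a nonlocal vertex algebra $V$ with a homomorphism of nonlocal vertex algebras $\rho:V\to V\otimes H$ such that $(\rho\otimes1)\rho=(1\otimes\Delta)\rho$ and $(1\otimes\varepsilon)\rho=\mathrm{Id}_V$. $Y_V^H$ and $\rho$ are compatible if $\rho(Y_V^H(h,x)v)=(Y_V^H(h,x)\otimes1)\rho(v)$ for $h\in H$, $v\in V$. *)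

(* Defs.v *)
From HB Require Import structures.
From mathcomp Require Import all_boot all_order all_algebra.
From mathcomp Require Import complex.
From mathcomp Require Import boolp classical_sets cardinality fsbigop reals.

Set Implicit Arguments.
Unset Strict Implicit.
Unset Printing Implicit Defensive.

Import Order.TTheory GRing.Theory Num.Theory.
Local Open Scope ring_scope.
Local Open Scope quotient_scope.
Local Open Scope classical_set_scope.

(* [:: (u1, v1); ...; (un, vn)] stands for the formal sum of the symbols
   u1 (x) v1 + ... + un (x) vn. No separate coefficients are needed, since
   a scalar can be absorbed into either factor. *)
Inductive tensor_cong (F : fieldType) (U V : lmodType F) :
    seq (U * V) -> seq (U * V) -> Prop :=
| tcong_refl s : tensor_cong s s
| tcong_sym s t : tensor_cong s t -> tensor_cong t s
| tcong_trans s t r : tensor_cong s t -> tensor_cong t r -> tensor_cong s r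
| tcong_cat s s' t t' :
    tensor_cong s s' -> tensor_cong t t' -> tensor_cong (s ++ t) (s' ++ t')
| tcong_comm s t : tensor_cong (s ++ t) (t ++ s)
| tcong_zero v : tensor_cong [:: (0, v)] [::]
| tcong_addl u u' v : tensor_cong [:: (u + u', v)] [:: (u, v); (u', v)]
| tcong_addr u v v' : tensor_cong [:: (u, v + v')] [:: (u, v); (u, v')]
| tcong_scale a u v : tensor_cong [:: (a *: u, v)] [:: (u, a *: v)].

Section TensorProduct.
Variables (F : fieldType) (U V : lmodType F).
Local Notation rep := (seq (U * V)).
Implicit Types s t r : rep.

Definition tensor_rel s t : bool := `[< tensor_cong s t >].

Fact tensor_rel_refl : reflexive tensor_rel.
Proof. by move=> s; apply/asboolP; constructor. Qed.

Fact tensor_rel_sym : symmetric tensor_rel.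
Proof. by move=> s t; apply/asboolP/asboolP => ?; apply: tcong_sym. Qed.

Fact tensor_rel_trans : transitive tensor_rel.
Proof.
move=> t s r /asboolP st /asboolP tr; apply/asboolP.
exact: tcong_trans st tr.
Qed.

Canonical tensor_equiv :=
  EquivRel tensor_rel tensor_rel_refl tensor_rel_sym tensor_rel_trans.

Definition tensor := {eq_quot tensor_equiv}.

HB.instance Definition _ := Choice.on tensor.
HB.instance Definition _ := EqQuotient.on tensor.

Definition tpure (u : U) (v : V) : tensor := \pi_tensor [:: (u, v)].

Definition tensor_zero : tensor := \pi_tensor [::].
Definition tensor_add (x y : tensor) : tensor :=
  \pi_tensor (repr x ++ repr y).
Definition tensor_opp (x : tensor) : tensor :=
  \pi_tensor [seq (- p.1, p.2) | p <- repr x].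
Definition tensor_scale (a : F) (x : tensor) : tensor :=
  \pi_tensor [seq (a *: p.1, p.2) | p <- repr x].

Lemma tensor_piP s t : tensor_cong s t <-> \pi_tensor s = \pi_tensor t.
Proof.
split=> [st|/eqmodP/asboolP//]; first by apply/eqmodP/asboolP.
Qed.

Lemma tensor_repr s : tensor_cong (repr (\pi_tensor s)) s.
Proof. by apply/tensor_piP; rewrite reprK. Qed.

Lemma tensor_ind (P : tensor -> Prop) :
  (forall s, P (\pi_tensor s)) -> forall x, P x.
Proof. by move=> Ps x; rewrite -[x]reprK. Qed.

Lemma tcong_map1 (f : U -> U) : f 0 = 0 -> {morph f : x y / x + y} ->
  (forall a x, f (a *: x) = a *: f x) -> forall s t, tensor_cong s t ->
  tensor_cong [seq (f p.1, p.2) | p <- s] [seq (f p.1, p.2) | p <- t].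
Proof.
move=> f0 fD fZ s t; elim=> {s t} /=.
- by move=> s; apply: tcong_refl.
- by move=> s t _; apply: tcong_sym.
- by move=> s t r _ st _; apply: tcong_trans.
- by move=> s s' t t' _ ss _ tt; rewrite !map_cat; apply: tcong_cat.
- by move=> s t; rewrite !map_cat; apply: tcong_comm.
- by move=> v; rewrite f0; apply: tcong_zero.
- by move=> u u' v; rewrite fD; apply: tcong_addl.
- by move=> u v v'; apply: tcong_addr.
- by move=> a u v; rewrite fZ; apply: tcong_scale.
Qed.

Lemma tensor_addE s t :
  tensor_add (\pi_tensor s) (\pi_tensor t) = \pi_tensor (s ++ t).
Proof. by apply/tensor_piP/tcong_cat; apply: tensor_repr. Qed.

Lemma tensor_oppE s :
  tensor_opp (\pi_tensor s) = \pi_tensor [seq (- p.1, p.2) | p <- s].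
Proof.
apply/tensor_piP/tcong_map1; [exact: oppr0|exact: opprD|  |exact: tensor_repr].
by move=> a x; rewrite scalerN.
Qed.

Lemma tensor_scaleE a s :
  tensor_scale a (\pi_tensor s) = \pi_tensor [seq (a *: p.1, p.2) | p <- s].
Proof.
apply/tensor_piP/tcong_map1;
  [exact: scaler0|exact: scalerDr|  |exact: tensor_repr].
by move=> b x; rewrite !scalerA mulrC.
Qed.

Fact tensor_addA : associative tensor_add.
Proof.
elim/tensor_ind=> s; elim/tensor_ind=> t; elim/tensor_ind=> r.
by rewrite !tensor_addE catA.
Qed.

Fact tensor_addC : commutative tensor_add.
Proof.
elim/tensor_ind=> s; elim/tensor_ind=> t; rewrite !tensor_addE.
by apply/tensor_piP; apply: tcong_comm.
Qed.

Fact tensor_add0 : left_id tensor_zero tensor_add.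
Proof. by elim/tensor_ind=> s; rewrite tensor_addE. Qed.

Lemma tensor_consE p s :
  \pi_tensor (p :: s) = tensor_add (tpure p.1 p.2) (\pi_tensor s).
Proof. by case: p => u v; rewrite tensor_addE. Qed.

Fact tensor_addN : left_inverse tensor_zero tensor_opp tensor_add.
Proof.
elim/tensor_ind; elim=> [|[u v] s IHs]; first by rewrite tensor_oppE tensor_addE.
rewrite tensor_oppE /= !tensor_consE /= -tensor_oppE.
rewrite -tensor_addA [X in tensor_add _ X]tensor_addA.
rewrite [tensor_add (tensor_opp _) _]tensor_addC -tensor_addA IHs.
rewrite [tensor_add _ tensor_zero]tensor_addC tensor_add0 tensor_addE /=.
apply/tensor_piP; apply: (tcong_trans _ (tcong_zero _ v)).
by apply: tcong_sym; rewrite -(addNr u); apply: tcong_addl.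
Qed.

HB.instance Definition _ := GRing.isZmodule.Build tensor
  tensor_addA tensor_addC tensor_add0 tensor_addN.

Fact tensor_scaleA a b x :
  tensor_scale a (tensor_scale b x) = tensor_scale (a * b) x.
Proof.
elim/tensor_ind: x => s; rewrite !tensor_scaleE -map_comp.
by congr \pi_tensor; apply: eq_map => p /=; rewrite scalerA.
Qed.

Fact tensor_scale1 : left_id 1 tensor_scale.
Proof.
elim/tensor_ind=> s; rewrite tensor_scaleE; congr \pi_tensor.
by rewrite -[RHS]map_id; apply: eq_map => -[u v] /=; rewrite scale1r.
Qed.

Fact tensor_scaleDr : right_distributive tensor_scale +%R.
Proof.
move=> a; elim/tensor_ind=> s; elim/tensor_ind=> t.
by rewrite /+%R /= !(tensor_addE, tensor_scaleE) map_cat.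
Qed.

Fact tensor_scaleDl x : {morph tensor_scale^~ x : a b / a + b}.
Proof.
move=> a b; elim/tensor_ind: x; elim=> [|[u v] s IHs].
  by rewrite !tensor_scaleE /= [RHS]tensor_addE.
move: IHs; rewrite !tensor_scaleE /= !tensor_consE => ->.
suff -> : tpure ((a + b) *: u) v = tpure (a *: u) v + tpure (b *: u) v.
  exact: (@addrACA tensor).
rewrite scalerDl [RHS]tensor_addE; apply/tensor_piP; exact: tcong_addl.
Qed.

HB.instance Definition _ := GRing.Zmodule_isLmodule.Build F tensor
  tensor_scaleA tensor_scale1 tensor_scaleDr tensor_scaleDl.

(* Sweedler sum: if x = \sum_i u_i (x) v_i, then tsum x B = \sum_i B u_i v_i.
   The chosen representative of x is irrelevant when B is bilinear, see
   [tsum_pi]; tsum ^~ B is then the linear map induced by B. *)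
Definition tsum (W : lmodType F) (x : tensor) (B : U -> V -> W) : W :=
  \sum_(p <- repr x) B p.1 p.2.

End TensorProduct.

Notation "u \ot v" := (tpure u v) (at level 40, left associativity) : ring_scope.

Definition bilinear_map (F : fieldType) (U V W : lmodType F)
    (B : U -> V -> W) : Prop :=
  (forall v, linear (B^~ v)) /\ (forall u, linear (B u)).

Section TensorLemmas.
Variables (F : fieldType) (U V : lmodType F).

Lemma tpure_bilinear : bilinear_map (@tpure F U V).
Proof.
have ZE a u v : a *: (u \ot v) = (a *: u) \ot v :> tensor U V.
  exact: tensor_scaleE.
split=> [v a u u'|u a v v']; rewrite ZE; rewrite [RHS]tensor_addE.
  apply/tensor_piP; exact: tcong_addl.
apply/tensor_piP; apply: tcong_trans (tcong_addr _ _ _) _.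
apply: (@tcong_cat _ _ _ [:: _] [:: _] [:: _] [:: _]); last exact: tcong_refl.
by apply: tcong_sym; apply: tcong_scale.
Qed.

Lemma tensor_pi_sum (s : seq (U * V)) :
  \pi_(tensor U V) s = \sum_(p <- s) p.1 \ot p.2.
Proof.
by elim: s => [|p s IHs]; rewrite ?big_nil// big_cons tensor_consE IHs.
Qed.

Variables (W : lmodType F) (B : U -> V -> W).
Hypothesis Bbil : bilinear_map B.

Lemma tsum_pi (s : seq (U * V)) :
  tsum (\pi_(tensor U V) s) B = \sum_(p <- s) B p.1 p.2.
Proof.
have [Bl Br] := Bbil.
have B0l v : B 0 v = 0.
  by have := Bl v (-1) 0 0; rewrite scaler0 addr0 scaleN1r addNr.
have BD u u' v : B (u + u') v = B u v + B u' v.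
  by have := Bl v 1 u u'; rewrite !scale1r.
have BZ a u v : B (a *: u) v = a *: B u v.
  by have := Bl v a u 0; rewrite !addr0 B0l addr0.
have B0r u : B u 0 = 0.
  by have := Br u (-1) 0 0; rewrite scaler0 addr0 scaleN1r addNr.
have /(_ _ _ (tensor_repr s)) // : forall t r : seq (U * V), tensor_cong t r ->
  \sum_(p <- t) B p.1 p.2 = \sum_(p <- r) B p.1 p.2.
move=> {s} t r; elim=> {t r} //=.
- by move=> s t r _ -> _ ->.
- by move=> s s' t t' _ e _ e'; rewrite !big_cat /= e e'.
- by move=> s t; rewrite !big_cat /= addrC.
- by move=> v; rewrite big_seq1 big_nil B0l.
- by move=> u u' v; rewrite !big_cons !big_nil !addr0 BD.
- move=> u v v'; rewrite !big_cons !big_nil !addr0 /=.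
  by have := Br u 1 v v'; rewrite !scale1r.
- move=> a u v; rewrite !big_seq1 /= BZ.
  by have := Br u a v 0; rewrite !addr0 B0r addr0.
Qed.

Lemma tsum_pure (u : U) (v : V) : tsum (u \ot v) B = B u v.
Proof. by rewrite tsum_pi big_seq1. Qed.

Lemma tsum_linear : linear (fun x : tensor U V => tsum x B).
Proof.
have [Bl _] := Bbil.
have B0l v : B 0 v = 0.
  by have := Bl v (-1) 0 0; rewrite scaler0 addr0 scaleN1r addNr.
move=> a; elim/tensor_ind=> s; elim/tensor_ind=> t.
rewrite [a *: _]tensor_scaleE [_ + _ in LHS]tensor_addE !tsum_pi.
rewrite big_cat big_map /= scaler_sumr; congr (_ + _); apply: eq_bigr => p _.
by have := Bl p.2 a p.1 0; rewrite !addr0 B0l addr0.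
Qed.

End TensorLemmas.

Section TensorMaps.
Variable F : fieldType.

Definition tmap (U V U' V' : lmodType F) (f : U -> U') (g : V -> V')
    (x : tensor U V) : tensor U' V' :=
  tsum x (fun u v => f u \ot g v).

Definition tassoc (U V W : lmodType F) (x : tensor (tensor U V) W) :
    tensor U (tensor V W) :=
  tsum x (fun y w => tsum y (fun u v => u \ot (v \ot w))).

Definition tswap (U V : lmodType F) (x : tensor U V) : tensor V U :=
  tsum x (fun u v => v \ot u).

End TensorMaps.

(* A doubly infinite formal series f(x) in W[[x, x^-1]] is the function
   sending n to the coefficient of x^n (so the mode v_n of Y(v, x) is the
   coefficient at - n - 1); A p q is the coefficient of x1^p x2^q in a series
   A(x1, x2). The sums over [set: int] and [set: int * int] below are
   mathcomp's finitely supported sums (0 if the support is infinite); they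
   are only used for products of series that exist, i.e. for which every
   coefficient is a finite sum. *)
Section FormalSeries.
Variable F : numFieldType.

Definition in_laurent (W : lmodType F) (f : int -> W) : Prop :=
  exists N : int, forall n, n < N -> f n = 0.

Definition in_laurent2 (W : lmodType F) (A : int -> int -> W) : Prop :=
  exists N : int, forall p q, (p < N) || (q < N) -> A p q = 0.

(* f lies in the image of W (x) F((x)) in W((x)) *)
Definition in_tensor_laurent (W : lmodType F) (f : int -> W) : Prop :=
  exists (r : nat) (w : 'I_r -> W) (c : 'I_r -> int -> F^o),
    (forall i, in_laurent (c i)) /\
    (forall n, f n = \sum_(i < r) c i n *: w i).

Definition const_series (W : lmodType F) (w : W) : int -> W :=
  fun n => if n == 0 then w else 0.

(* p (p - 1) ... (p - j + 1) / j! *)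
Definition binz (p : int) (j : nat) : F :=
  (\prod_(i < j) (p%:~R - i%:R)) / j`!%:R.

(* (x1 - x2)^k A(x1, x2) *)
Definition mul_subX (W : lmodType F) (k : nat) (A : int -> int -> W) :
    int -> int -> W :=
  fun p q => \sum_(i < k.+1)
    ((-1) ^+ i * ('C(k, i))%:R) *: A (p - (k - i)%N%:Z) (q - i%:Z).

(* The coefficient of x0^m x2^n in A(x2 + x0, x2), expanded in nonnegative
   powers of x0. *)
Definition subst_add (W : lmodType F) (A : int -> int -> W) :
    int -> int -> W :=
  fun m n => if m is Posz j
    then \sum_(p \in [set: int]) binz p j *: A p (n + m - p) else 0.

(* f(x1 - x2), expanded in nonnegative powers of x2. *)
Definition subst_sub (W : lmodType F) (f : int -> W) : int -> int -> W :=
  fun p q => if q is Posz j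
    then ((-1) ^+ j * binz (p + q) j) *: f (p + q) else 0.

(* f(x) (x) g(x) *)
Definition series_tensor (U V : lmodType F) (f : int -> U) (g : int -> V) :
    int -> tensor U V :=
  fun n => \sum_(j \in [set: int]) f j \ot g (n - j).

End FormalSeries.

(* A vertex operator map Y is curried as Y u v n, the coefficient of x^n in
   Y(u, x)v. *)
Section NonlocalVertexAlgebras.
Variable F : numFieldType.

Definition is_vertex_map (V W : lmodType F) (Y : V -> W -> int -> W) : Prop :=
  (forall n, bilinear_map (fun v w => Y v w n)) /\
  (forall v w, in_laurent (Y v w)).

(* Y_W(u, x1) Y_W(v, x2) w *)
Definition iterate (V W : lmodType F) (YW : V -> W -> int -> W)
    (u v : V) (w : W) : int -> int -> W :=
  fun p q => YW u (YW v w q) p.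

Definition weakly_associative (V W : lmodType F) (Y : V -> V -> int -> V)
    (YW : V -> W -> int -> W) : Prop :=
  forall u v, exists k : nat, forall w,
    let A := mul_subX k (iterate YW u v w) in
    in_laurent2 A /\
    forall m n, subst_add A m n = YW (Y u v (m - k%:Z)) w n.

Definition is_nva (V : lmodType F) (Y : V -> V -> int -> V) (vac : V) : Prop :=
  [/\ is_vertex_map Y,
      forall v n, Y vac v n = const_series v n,
      forall v, (forall n, n < 0 -> Y v vac n = 0) /\ Y v vac 0 = v
    & weakly_associative Y Y].

Definition is_nva_hom (V V' : lmodType F)
    (Y : V -> V -> int -> V) (vac : V) (Y' : V' -> V' -> int -> V') (vac' : V')
    (f : V -> V') : Prop :=
  [/\ linear f, f vac = vac' & forall u v n, f (Y u v n) = Y' (f u) (f v) n].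

Definition is_nva_module (V : lmodType F) (Y : V -> V -> int -> V) (vac : V)
    (W : lmodType F) (YW : V -> W -> int -> W) : Prop :=
  [/\ is_vertex_map YW,
      forall w n, YW vac w n = const_series w n
    & weakly_associative Y YW].

Definition tensor_Y (V V' : lmodType F) (Y : V -> V -> int -> V)
    (Y' : V' -> V' -> int -> V') :
    tensor V V' -> tensor V V' -> int -> tensor V V' :=
  fun s t n => tsum s (fun u a => tsum t (fun v b =>
    series_tensor (Y u v) (Y' a b) n)).

Definition scalar_Y : F^o -> F^o -> int -> F^o :=
  fun a b => const_series (a * b : F^o).

Definition is_coalgebra (H : lmodType F) (Delta : H -> tensor H H)
    (eps : H -> F^o) : Prop :=
  [/\ linear Delta, linear eps,
      forall h, tassoc (tmap Delta id (Delta h)) = tmap id Delta (Delta h),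
      forall h, tsum (Delta h) (fun h1 h2 => eps h1 *: h2) = h
    & forall h, tsum (Delta h) (fun h1 h2 => eps h2 *: h1) = h].

Definition is_nv_bialgebra (H : lmodType F) (Y : H -> H -> int -> H) (vac : H)
    (Delta : H -> tensor H H) (eps : H -> F^o) : Prop :=
  [/\ is_nva Y vac,
      is_coalgebra Delta eps,
      is_nva_hom Y vac (tensor_Y Y Y) (vac \ot vac) Delta
    & is_nva_hom Y vac scalar_Y 1 eps].

Definition is_cocommutative (H : lmodType F) (Delta : H -> tensor H H) : Prop :=
  forall h, tswap (Delta h) = Delta h.

Definition is_module_nva (H : lmodType F) (YH : H -> H -> int -> H) (vacH : H)
    (Delta : H -> tensor H H) (eps : H -> F^o)
    (V : lmodType F) (Y : V -> V -> int -> V) (vac : V)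
    (YVH : H -> V -> int -> V) : Prop :=
  [/\ is_nva Y vac,
      is_nva_module YH vacH YVH,
      forall h v, in_tensor_laurent (YVH h v),
      forall h n, YVH h vac n = const_series (eps h *: vac) n
    & (* the coefficients of x1^p x2^q; (i, j) are the exponents of x1 and x2
         contributed by Y_V^H(h1, x1 - x2) u *)
      forall h u v p q,
        YVH h (Y u v q) p =
        tsum (Delta h) (fun h1 h2 => \sum_(ij \in [set: int * int])
          Y (subst_sub (YVH h1 u) ij.1 ij.2)
            (YVH h2 v (p - ij.1)) (q - ij.2))].

Definition is_comodule_nva (H : lmodType F) (YH : H -> H -> int -> H)
    (vacH : H) (Delta : H -> tensor H H) (eps : H -> F^o)
    (V : lmodType F) (Y : V -> V -> int -> V) (vac : V)
    (rho : V -> tensor V H) : Prop :=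
  [/\ is_nva Y vac,
      is_nva_hom Y vac (tensor_Y Y YH) (vac \ot vacH) rho,
      forall v, tassoc (tmap rho id (rho v)) = tmap id Delta (rho v)
    & forall v, tsum (rho v) (fun v1 h => eps h *: v1) = v].

Definition are_compatible (H V : lmodType F) (YVH : H -> V -> int -> V)
    (rho : V -> tensor V H) : Prop :=
  forall h v n, rho (YVH h v n) = tmap (fun v1 => YVH h v1 n) id (rho v).

(* Y(u, x) f(x), both series in the same variable *)
Definition apply_series (V : lmodType F) (Y : V -> V -> int -> V) (u : V)
    (f : int -> V) : int -> V :=
  fun n => \sum_(j \in [set: int]) Y u (f j) (n - j).

Definition smash_Y (H : lmodType F) (YH : H -> H -> int -> H)
    (Delta : H -> tensor H H) (V : lmodType F) (Y : V -> V -> int -> V)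
    (YVH : H -> V -> int -> V) :
    tensor V H -> tensor V H -> int -> tensor V H :=
  fun s t n => tsum s (fun u h => tsum t (fun v h' =>
    tsum (Delta h) (fun h1 h2 =>
      series_tensor (apply_series Y u (YVH h1 v)) (YH h2 h') n))).

Definition deformed_Y (H V : lmodType F) (Y : V -> V -> int -> V)
    (YVH : H -> V -> int -> V) (rho : V -> tensor V H) : V -> V -> int -> V :=
  fun a v n => tsum (rho a) (fun a1 a2 => apply_series Y a1 (YVH a2 v) n).

End NonlocalVertexAlgebras.

(* Main.v *)
(* The module axiom of [H] on [V], applied to [Y(a1, x1) YVH(a2, x1) Y(b1, x2)],
   turns a product of two deformed operators into
     sum Y(a1, x1) Y(YVH(a2, x1 - x2) b1, x2) YVH(a3, x1) YVH(b2, x2) w.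
   As [YVH(h, x) v] lies in [V (x) C((x))], this is a finite sum of terms
     c(x1 - x2) E(x1, x2) Y(a1, x1) Y(v, x2) w'  with c, E scalar series,
   so weak associativity of [Y] and multiplicativity of [x1 = x2 + x0] give it
   the iterate
     sum Y(Y(a1, x0) YVH(a2, x0) b1, x2) YVH(YH(a3, x0) b2, x2) w.
   Compatibility, coassociativity and cocommutativity show that [rho] maps the
   deformed product to the smash product, which identifies this sum with the
   iterate of the deformed operators. *)
Require Import Defs.
From HB Require Import structures.
From mathcomp Require Import all_boot all_order all_algebra finmap.
From mathcomp Require Import complex reals.
From mathcomp Require Import boolp classical_sets fsbigop.
From mathcomp Require Import zify ring.

Set Implicit Arguments.
Unset Strict Implicit.
Unset Printing Implicit Defensive.

Import Order.TTheory GRing.Theory Num.Theory.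
Local Open Scope ring_scope.
Local Open Scope complex_scope.

(** Two obstacles shape the argument. First, the exponent [k] of weak associativity must be fixed
    before the vector [w] is given. The series [c] and the vectors [v] come from [YVH(a2, x) b1], so
    they depend on the two operators alone and determine [k]. All that depends on [w] sits in
    [YVH(a3, x1) YVH(b2, x2) w], which lies in [V (x) C((x1, x2))] and therefore admits
    [x1 = x2 + x0] as it stands. Second, products of doubly infinite series need not be associative,
    and a sum with infinite support silently takes the value 0. The product side is kept among
    series that are Laurent in [x2] with coefficients Laurent in [x1], the iterate side among series
    Laurent in [x0] with coefficients Laurent in [x2]. In either space a triple product has finite
    coefficients, which justifies the regroupings. The substitution is performed only after powers
    of [x1 - x2] have brought every factor into series bounded below in both variables. *)

Section LinearFacts.
Variables (F : fieldType) (U V : lmodType F) (L : U -> V).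
Hypothesis linL : linear L.

Lemma lin0 : L 0 = 0.
Proof. by have := linL (-1) 0 0; rewrite scaler0 addr0 scaleN1r addNr. Qed.

Lemma linD u v : L (u + v) = L u + L v.
Proof. by have := linL 1 u v; rewrite !scale1r. Qed.

Lemma linZ a u : L (a *: u) = a *: L u.
Proof. by have := linL a u 0; rewrite !addr0 lin0 addr0. Qed.

Lemma lin_sum (I : Type) (r : seq I) (P : pred I) (f : I -> U) :
  L (\sum_(i <- r | P i) f i) = \sum_(i <- r | P i) L (f i).
Proof. by apply: (big_morph L linD lin0). Qed.

End LinearFacts.

(** * Finitely supported sums *)

Section FiniteSums.
Variable W : zmodType.

(* Junk value: [fsum f = 0] when the support of [f] is infinite. *)
Definition fsum (I : choiceType) (f : I -> W) : W :=
  \sum_(i \in [set: I]%classic) f i.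

Definition finsupp (I : choiceType) (f : I -> W) : Prop :=
  exists s : seq I, forall i, f i != 0 -> i \in s.

Lemma fsum_seq (I : choiceType) (s : seq I) (f : I -> W) :
  uniq s -> (forall i, f i != 0 -> i \in s) -> fsum f = \sum_(i <- s) f i.
Proof.
move=> us fs; rewrite /fsum (fsbigTE [fset x | x in s]%fset).
  by apply: perm_big; rewrite uniq_perm// => i; rewrite !inE.
by move=> i; rewrite !inE /=; apply: contraNeq; apply: fs.
Qed.

Lemma finsupp_uniq (I : choiceType) (f : I -> W) :
  finsupp f -> exists2 s : seq I, uniq s & forall i, f i != 0 -> i \in s.
Proof.
by move=> [s fs]; exists (undup s); rewrite ?undup_uniq// => i;
  rewrite mem_undup; apply: fs.
Qed.

Lemma eq_fsum (I : choiceType) (f g : I -> W) : f =1 g -> fsum f = fsum g.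
Proof. by move=> /funext ->. Qed.

Lemma fsum0 (I : choiceType) (f : I -> W) : (forall i, f i = 0) -> fsum f = 0.
Proof. by move=> f0; rewrite (@fsum_seq _ [::]) ?big_nil// => i;
  rewrite f0 eqxx. Qed.

Lemma fsum_one (I : choiceType) (i0 : I) (f : I -> W) :
  (forall i, i != i0 -> f i = 0) -> fsum f = f i0.
Proof.
move=> f0; rewrite (@fsum_seq _ [:: i0]) ?big_seq1// => i.
by rewrite inE; apply: contraNT => /f0 ->.
Qed.

Lemma finsupp0 (I : choiceType) (f : I -> W) : (forall i, f i = 0) -> finsupp f.
Proof. by move=> f0; exists [::] => i; rewrite f0 eqxx. Qed.

(** The second hypothesis is [finsupp g] unfolded: inside the section [finsupp] is tied to [W],
    while [g] takes values in another group. *)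
Lemma sub_finsupp (W' : zmodType) (I : choiceType) (f : I -> W) (g : I -> W') :
  (forall i, g i = 0 -> f i = 0) ->
  (exists s : seq I, forall i, g i != 0 -> i \in s) -> finsupp f.
Proof.
move=> gf [s gs]; exists s => i fi; apply: gs; apply: contraNneq fi => /gf ->.
exact: eqxx.
Qed.

Lemma finsuppD (I : choiceType) (f g : I -> W) :
  finsupp f -> finsupp g -> finsupp (fun i => f i + g i).
Proof.
move=> [s fs] [t gt]; exists (s ++ t) => i; rewrite mem_cat.
apply: contraR; rewrite negb_or => /andP[/(contraNeq (fs i)) -> ].
by move=> /(contraNeq (gt i)) ->; rewrite addr0.
Qed.

Lemma finsupp_sum (I : choiceType) (J : Type) (r : seq J) (f : J -> I -> W) :
  (forall j, finsupp (f j)) -> finsupp (fun i => \sum_(j <- r) f j i).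
Proof.
move=> ff; elim: r => [|j r IH]; first by apply: finsupp0 => i; rewrite big_nil.
have -> : (fun i => \sum_(j <- j :: r) f j i) =
          (fun i => f j i + \sum_(j <- r) f j i).
  by apply: funext => i; rewrite big_cons.
exact: finsuppD.
Qed.

Lemma finsupp_comp (I J : choiceType) (h : J -> I) (h' : I -> J) (f : I -> W) :
  cancel h h' -> finsupp f -> finsupp (fun j => f (h j)).
Proof.
move=> hK [s fs]; exists (map h' s) => j /fs js.
by rewrite -[j]hK map_f.
Qed.

Lemma finsupp_swap (I J : choiceType) (f : I * J -> W) :
  finsupp f -> finsupp (fun ji : J * I => f (ji.2, ji.1)).
Proof.
by apply: (finsupp_comp (h := fun ji => (ji.2, ji.1)) (h' :=
  fun ij => (ij.2, ij.1))) => -[].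
Qed.

Lemma fsumD (I : choiceType) (f g : I -> W) : finsupp f -> finsupp g ->
  fsum (fun i => f i + g i) = fsum f + fsum g.
Proof.
move=> [s fs] [t gt]; pose r := undup (s ++ t).
have fr i : f i != 0 -> i \in r.
  by move=> /fs is_; rewrite mem_undup mem_cat is_.
have gr i : g i != 0 -> i \in r.
  by move=> /gt is_; rewrite mem_undup mem_cat is_ orbT.
rewrite !(@fsum_seq _ r) ?undup_uniq ?big_split// => i.
by apply: contraR => ir; rewrite (contraNeq (fr i) ir) (contraNeq (gr i) ir)
  addr0.
Qed.

Lemma fsum_sum (I : choiceType) (J : Type) (r : seq J) (f : J -> I -> W) :
  (forall j, finsupp (f j)) ->
  fsum (fun i => \sum_(j <- r) f j i) = \sum_(j <- r) fsum (f j).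
Proof.
move=> ff; elim: r => [|j r IH].
  by rewrite big_nil fsum0// => i; rewrite big_nil.
rewrite big_cons -IH -fsumD//; last exact: finsupp_sum.
by apply: eq_fsum => i; rewrite big_cons.
Qed.

Lemma fsum_reindex (I J : choiceType) (h : J -> I) (h' : I -> J) (f : I -> W) :
  cancel h h' -> cancel h' h -> fsum f = fsum (fun j => f (h j)).
Proof.
by move=> hK h'K; apply: reindex_fsbigT; exists h'.
Qed.

Lemma finsupp_slice (I J : choiceType) (f : I * J -> W) i :
  finsupp f -> finsupp (fun j => f (i, j)).
Proof.
by move=> [s fs]; exists (map snd s) => j /fs /(map_f snd).
Qed.

Lemma fsum_pair (I J : choiceType) (f : I * J -> W) : finsupp f ->
  fsum f = fsum (fun i => fsum (fun j => f (i, j))).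
Proof.
move=> [s fs].
pose s1 := undup (map fst s); pose s2 := undup (map snd s).
have f1 i j : f (i, j) != 0 -> i \in s1.
  by move=> /fs /(map_f fst); rewrite mem_undup.
have f2 i j : f (i, j) != 0 -> j \in s2.
  by move=> /fs /(map_f snd); rewrite mem_undup.
rewrite (@fsum_seq _ s1) ?undup_uniq//; last first.
  move=> i; apply: contraR => is1; rewrite fsum0// => j.
  by apply: contraNeq is1; apply: f1.
rewrite (eq_bigr (fun i => \sum_(j <- s2) f (i, j))); last first.
  by move=> i _; apply: fsum_seq; [exact: undup_uniq|exact: f2].
rewrite (@fsum_seq _ (allpairs pair s1 s2)).
- by rewrite big_allpairs.
- by rewrite allpairs_uniq ?undup_uniq// => -[? ?] [? ?].
- by move=> [i j] fij; rewrite allpairs_f// ?(f1 _ _ fij)// (f2 _ _ fij).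
Qed.

Lemma finsupp_fsum (I J : choiceType) (f : I * J -> W) : finsupp f ->
  finsupp (fun i => fsum (fun j => f (i, j))).
Proof.
move=> [s fs]; exists (map fst s) => i; apply: contraR => is1.
rewrite fsum0// => j; apply: contraNeq is1 => /fs /(map_f fst); exact.
Qed.

Lemma fsum_pair_swap (I J : choiceType) (f : I * J -> W) : finsupp f ->
  fsum f = fsum (fun j => fsum (fun i => f (i, j))).
Proof.
move=> ff; pose sw (K L : Type) (p : K * L) := (p.2, p.1).
have swK K L : cancel (@sw K L) (@sw L K) by case.
rewrite (fsum_reindex _ (swK _ _) (swK _ _)) fsum_pair//.
exact: finsupp_comp (swK _ _) ff.
Qed.

End FiniteSums.

Section LinearSums.
Variables (F : fieldType) (U V : lmodType F) (L : U -> V).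
Hypothesis linL : linear L.

Lemma fsum_lin (I : choiceType) (f : I -> U) : finsupp f ->
  L (fsum f) = fsum (fun i => L (f i)).
Proof.
move=> [s0 fs0]; have [s us fs] := finsupp_uniq (ex_intro _ s0 fs0).
rewrite !(fsum_seq us)//; first by rewrite (lin_sum linL).
by move=> i Lfi; apply: fs; apply: contraNneq Lfi => ->; rewrite (lin0 linL).
Qed.

End LinearSums.

Lemma scale_linear (F : fieldType) (W : lmodType F) (a : F) :
  linear (fun w : W => a *: w).
Proof. by move=> b u v; rewrite scalerDr !scalerA mulrC. Qed.

Lemma scale_linearl (F : fieldType) (W : lmodType F) (w : W) :
  linear (fun a : F^o => a *: w).
Proof. by move=> b u v; rewrite scalerDl scalerA. Qed.

Definition irange (a b : int) : seq int :=
  [seq a + i%:Z | i <- iota 0 `|(b - a + 1)%R|%N].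

Lemma mem_irange (a b i : int) : a <= i <= b -> i \in irange a b.
Proof.
move=> iab; have -> : i = a + `|(i - a)%R|%N%:Z by lia.
by apply: map_f; rewrite mem_iota; lia.
Qed.

Lemma finsupp_int (W : zmodType) (f : int -> W) (a b : int) :
  (forall i, f i != 0 -> a <= i <= b) -> finsupp f.
Proof. by move=> fab; exists (irange a b) => i /fab/mem_irange. Qed.

Lemma finsupp_box (W : zmodType) (f : int * int -> W) (a b c d : int) :
  (forall i j, f (i, j) != 0 -> a <= i <= b /\ c <= j <= d) -> finsupp f.
Proof.
move=> fab; exists (allpairs pair (irange a b) (irange c d)) => -[i j] /fab[*].
by apply: allpairs_f; apply: mem_irange.
Qed.

Lemma finsupp_box2 (W : zmodType) (f : (int * int) * (int * int) -> W)
    (a b c d a' b' c' d' : int) :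
  (forall i j k l, f ((i, j), (k, l)) != 0 -> [/\ a <= i <= a', b <= j <= b',
     c <= k <= c' & d <= l <= d']) -> finsupp f.
Proof.
move=> fab; exists (allpairs pair (allpairs pair (irange a a') (irange b b'))
  (allpairs pair (irange c c') (irange d d'))).
by move=> [[i j] [k l]] /fab[*]; do 2!apply: allpairs_f; apply: mem_irange.
Qed.
(** Only the scaled family is assumed finite: for [a = 0] both sides vanish even if [fsum f] is a
    default value, and otherwise scaling preserves the support. *)
Lemma fsum_scale (F : fieldType) (W : lmodType F) (I : choiceType) (a : F)
    (f : I -> W) :
  finsupp (fun i => a *: f i) -> a *: fsum f = fsum (fun i => a *: f i).
Proof.
have [->|a0 af] := eqVneq a 0.
  by move=> _; rewrite scale0r fsum0// => i; rewrite scale0r.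
apply: (fsum_lin (scale_linear a)); apply: sub_finsupp af => i /eqP.
by rewrite scaler_eq0 (negPf a0) => /eqP.
Qed.

Lemma fsum_scalel (F : fieldType) (W : lmodType F) (I : choiceType)
    (f : I -> F^o) (w : W) :
  finsupp (fun i => f i *: w) -> fsum f *: w = fsum (fun i => f i *: w).
Proof.
have [->|w0 fw] := eqVneq w 0.
  by move=> _; rewrite scaler0 fsum0// => i; rewrite scaler0.
apply: (fsum_lin (scale_linearl w)); apply: sub_finsupp fw => i /eqP.
by rewrite scaler_eq0 (negPf w0) orbF => /eqP.
Qed.

Lemma fsum_mulscale (F : fieldType) (W : lmodType F) (I : choiceType)
    (f : I -> F) (w : W) :
  finsupp (fun i => f i *: w) -> fsum f *: w = fsum (fun i => f i *: w).
Proof. exact: (@fsum_scalel F W I f w). Qed.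

(** * Products and expansions of formal series *)

Section Convolution.
Variables (F : fieldType) (G : zmodType).

(** The Cauchy product, with exponents in an arbitrary group so that one definition serves one and
    two variables. An infinite coefficient gets the default 0, hence the condition [STAfin] on
    triple products: existence of the pairwise products alone does not give associativity. *)
Definition conv (W : lmodType F) (S : G -> F) (A : G -> W) : G -> W :=
  fun g => fsum (fun h => S h *: A (g - h)).

Variables (W : lmodType F) (S T : G -> F) (A : G -> W) (g : G).
Hypothesis STAfin :
  finsupp (fun hk : G * G => S hk.1 *: (T hk.2 *: A (g - hk.1 - hk.2))).

Lemma conv_convE : conv S (conv T A) g =
  fsum (fun hk : G * G => S hk.1 *: (T hk.2 *: A (g - hk.1 - hk.2))).
Proof.
rewrite fsum_pair//; apply: eq_fsum => h /=.
by rewrite fsum_scale//; apply: finsupp_slice h STAfin.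
Qed.

Lemma conv_comm : conv S (conv T A) g = conv T (conv S A) g.
Proof.
rewrite conv_convE fsum_pair_swap//; apply: eq_fsum => k /=.
rewrite fsum_scale; last first.
  have /(finsupp_slice k) /= := finsupp_swap STAfin.
  by apply: sub_finsupp => h <-; rewrite addrAC !scalerA mulrC.
by apply: eq_fsum => h /=; rewrite addrAC !scalerA mulrC.
Qed.

Lemma conv_assoc : conv S (conv T A) g = conv (conv S (T : G -> F^o)) A g.
Proof.
(* After this shear the second index is the exponent contributed by the product of [S] and [T]. *)
pose sh (hk : G * G) : G * G := (hk.1, hk.2 - hk.1).
pose sh' (hk : G * G) : G * G := (hk.1, hk.2 + hk.1).
have shK : cancel sh sh' by move=> [h k]; rewrite /sh /sh' /= subrK.
have shK' : cancel sh' sh by move=> [h k]; rewrite /sh /sh' /= addrK.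
have shfin := finsupp_comp shK STAfin.
rewrite conv_convE (fsum_reindex _ shK shK') fsum_pair_swap//.
apply: eq_fsum => k /=; have E h : g - h - (k - h) = g - k.
  by rewrite opprB addrA subrK.
rewrite fsum_scalel.
  by apply: eq_fsum => h; rewrite E scalerA.
have /(finsupp_slice k) /= := finsupp_swap shfin.
by apply: sub_finsupp => h; rewrite /= E scalerA.
Qed.

End Convolution.

(** * Binomial coefficients and the Vandermonde identity *)

Section Binomials.
Variable F : numFieldType.

(** Extended by 0 to negative lower indices, so that Pascal's rule and Vandermonde's identity hold
    over all integers without boundary cases. *)
Definition binzZ (p m : int) : F := if m is Posz j then binz F p j else 0.

Lemma binzZ_lt0 p m : m < 0 -> binzZ p m = 0.
Proof. by case: m. Qed.

Lemma binzZ0 p : binzZ p 0 = 1.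
Proof. by rewrite /binzZ /= /binz big_ord0 fact0 divr1. Qed.

Lemma binzZ0l m : binzZ 0 m = (m == 0)%:R.
Proof.
case: m => [[|j]|//]; first by rewrite binzZ0 eqxx.
by rewrite /binzZ /binz big_ord_recl /= subr0 !mul0r.
Qed.

Lemma binzZ_pascal p m : binzZ (p + 1) m = binzZ p m + binzZ p (m - 1).
Proof.
case: m => [[|j]|j]; first by rewrite !binzZ0 addr0.
- have -> : Posz j.+1 - 1 = Posz j by lia.
  rewrite /binzZ /binz big_ord_recl big_ord_recr /= subr0 factS natrM.
  have E (i : 'I_j) : (p + 1)%:~R - (bump 0 i)%:R = p%:~R - i%:R :> F.
    by rewrite /bump /= add1n -natr1 intrD opprD addrACA subrr addr0.
  rewrite (eq_bigr _ (fun i _ => E i)) intrD.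
  set P := \prod_(_ < _) _.
  have j0 : j.+1%:R != 0 :> F by rewrite pnatr_eq0.
  have f0 : j`!%:R != 0 :> F by rewrite pnatr_eq0 -lt0n fact_gt0.
  rewrite -natr1 in j0 *.
  by field; rewrite f0 j0.
- by rewrite !binzZ_lt0 ?addr0//; lia.
Qed.

Lemma binzZ_nat (k i : nat) : binzZ k i = 'C(k, i)%:R.
Proof.
elim: k i => [|k IH] [|i]; rewrite ?bin0 ?binzZ0//;
  first by rewrite binzZ0l bin0n.
have -> : Posz k.+1 = k%:Z + 1 by lia.
by rewrite binzZ_pascal (_ : i.+1%:Z - 1 = i) ?IH ?binS ?natrD//; lia.
Qed.

Lemma int_periodic (T : Type) (f : int -> T) :
  (forall p, f (p + 1) = f p) -> forall p, f p = f 0.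
Proof.
move=> f1; elim/int_rect => // n IH; first by rewrite -IH -[RHS]f1; congr f;
  lia.
by rewrite -IH -[LHS]f1; congr f; lia.
Qed.

Lemma binzZ_neq0 p m : binzZ p m != 0 -> 0 <= m.
Proof. by apply: contraR; rewrite -ltNge => /binzZ_lt0 ->. Qed.

Lemma vandermonde_fin p q m : finsupp (fun j => binzZ p j * binzZ q (m - j)).
Proof.
apply: (@finsupp_int _ _ 0 m) => j; rewrite mulf_eq0 negb_or => /andP[].
by move=> /binzZ_neq0 ? /binzZ_neq0 ?; lia.
Qed.

(* Both sides minus each other satisfy Pascal's rule in [p], so by induction on
   [m] the difference does not depend on [p]; it vanishes at [p = 0]. *)
Lemma vandermonde p q m : fsum (fun j => binzZ p j * binzZ q (m - j)) = binzZ (p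
  + q) m.
Proof.
have neg m' p' : m' < 0 -> fsum (fun j => binzZ p' j * binzZ q (m' - j)) = 0.
  move=> m0; apply: fsum0 => j; have [j0|j0] := ltP j 0.
    by rewrite binzZ_lt0 ?mul0r.
  by rewrite mulrC binzZ_lt0 ?mul0r//; lia.
case: m => [m|m]; last by rewrite neg.
elim: m p => [|m IH] p.
  rewrite (@fsum_one _ _ 0) ?subr0 ?binzZ0 ?mulr1// => j j0.
  have [jlt|jge] := ltP j 0; first by rewrite binzZ_lt0 ?mul0r.
  by rewrite mulrC binzZ_lt0 ?mul0r//; lia.
pose D p := fsum (fun j => binzZ p j * binzZ q (m.+1%:Z - j)) - binzZ (p + q)
  m.+1.
suff : D p = 0 by move/eqP; rewrite subr_eq0 => /eqP.
rewrite (@int_periodic _ D).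
  rewrite /D (@fsum_one _ _ 0) => [|j j0]; last first.
    by rewrite binzZ0l (negPf j0) mul0r.
  by rewrite binzZ0 mul1r subr0 add0r subrr.
move=> {}p; rewrite /D (_ : p + 1 + q = p + q + 1); last by lia.
rewrite binzZ_pascal (_ : m.+1%:Z - 1 = m); last by lia.
rewrite -IH [X in X - _](_ : _ = fsum (fun j => binzZ p j * binzZ q (m.+1%:Z -
  j)) +
    fsum (fun j => binzZ p j * binzZ q (m%:Z - j))).
  by rewrite opprD addrACA subrr addr0.
have sK : cancel (fun j : int => j + 1) (fun j => j - 1).
  by move=> j; rewrite addrK.
have sK' : cancel (fun j : int => j - 1) (fun j => j + 1).
  by move=> j; rewrite subrK.
have E j : m%:Z - (j - 1) = m.+1%:Z - j by lia.
rewrite (fsum_reindex (fun j => binzZ p j * binzZ q (m%:Z - j)) sK' sK) -fsumD.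
- by apply: eq_fsum => j; rewrite binzZ_pascal mulrDl E.
- exact: vandermonde_fin.
- exact: (finsupp_comp sK' (vandermonde_fin p q m)).
Qed.

End Binomials.

(** * The expansion of [c(x1 - x2)] in nonnegative powers of [x2] *)

Section SubstSub.
Variable F : numFieldType.
Notation binzZ := (@binzZ F).

(** The coefficient of [x1^p x2^q] in [(x1 - x2)^(p + q)]; by homogeneity no other power of
    [x1 - x2] contains this monomial. *)
Definition expand_sub_coef (g : int * int) : F :=
  (-1) ^ g.2 * binzZ (g.1 + g.2) g.2.

(* [c(x1 - x2)] as a series indexed by the pairs of exponents. *)
Definition expand_sub (c : int -> F) (g : int * int) : F :=
  expand_sub_coef g * c (g.1 + g.2).

Lemma subst_subE (W : lmodType F) (f : int -> W) p q :
  subst_sub f p q = expand_sub_coef (p, q) *: f (p + q).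
Proof. by case: q => [j|j] //=; rewrite /expand_sub_coef /= mulr0 scale0r. Qed.

Lemma expand_sub_neq0 c p q : expand_sub c (p, q) != 0 ->
  c (p + q) != 0 /\ 0 <= q.
Proof.
rewrite /expand_sub /expand_sub_coef /= !mulf_eq0 !negb_or =>
  /andP[/andP[_ /binzZ_neq0 ->]] ->.
by [].
Qed.

(** Substituting [x1 - x2] is multiplicative: once the degree [n] taken from [c] is fixed, the sum
    over the exponent of [x2] is a Vandermonde sum. The lower bound [N] keeps the double sum
    finite. *)
Lemma conv_expand_sub (c d : int -> F) (N : int) : (forall n, c n != 0 ->
  N <= n) ->
  (forall n, d n != 0 -> N <= n) ->
  conv (expand_sub c) (expand_sub d : _ -> F^o) =1 expand_sub (conv c (d : _ ->
    F^o)).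
Proof.
move=> cN dN [p q].
pose h (nj : int * int) := (nj.1 - nj.2, nj.2).
pose h' (nj : int * int) := (nj.1 + nj.2, nj.2).
have hK : cancel h h' by move=> [n j]; rewrite /h /h' /= subrK.
have h'K : cancel h' h by move=> [n j]; rewrite /h /h' /= addrK.
rewrite /conv (fsum_reindex _ hK h'K).
have E n j : expand_sub c (h (n, j)) *: (expand_sub d ((p, q) - h (n, j)) : F^o)
  =
  (-1) ^ q * (c n * d (p + q - n)) * (binzZ n j * binzZ (p + q - n) (q - j)).
  rewrite /expand_sub /expand_sub_coef /= subrK (_ : p - (n - j) + (q - j) = p +
    q - n).
    have -> : (-1 : F) ^ q = (-1) ^ j * (-1) ^ (q - j).
      by rewrite -expfzDr ?oppr_eq0 ?oner_eq0//; congr (_ ^ _); lia.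
    by rewrite /GRing.scale /=; ring.
  by lia.
rewrite fsum_pair; last first.
  apply: (@finsupp_box _ _ N (p + q - N) 0 q) => n j; rewrite E.
  rewrite !mulf_eq0 !negb_or => /andP[/andP[_ /andP[/cN ? /dN ?]]].
  by move=> /andP[/binzZ_neq0 ? /binzZ_neq0 ?]; split; lia.
rewrite /expand_sub /expand_sub_coef /= -[RHS]/(_ *: (fsum _ : F^o)) fsum_scale;
  last first.
  apply: (@finsupp_int _ _ N (p + q - N)) => n.
  by rewrite !scaler_eq0 !negb_or => /andP[_ /andP[/cN ? /dN ?]]; lia.
apply: eq_fsum => n; rewrite (eq_fsum (E n)).
have -> : (fun j => (-1) ^ q * (c n * d (p + q - n)) *
    (binzZ n j * binzZ (p + q - n) (q - j))) =
  (fun j => ((-1) ^ q * (c n * d (p + q - n))) *: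
    (binzZ n j * binzZ (p + q - n) (q - j) : F^o)) by [].
rewrite -(@fsum_lin F F^o F^o _ (scale_linear _)); last exact: vandermonde_fin.
rewrite vandermonde /GRing.scale /= (_ : n + (p + q - n) = p + q); last by lia.
by ring.
Qed.

End SubstSub.

(** * The substitution [x1 = x2 + x0] *)

Section SubstAdd.
Variable F : numFieldType.
Notation binzZ := (@binzZ F).

Definition laurent2 (W : zmodType) (A : int * int -> W) : Prop :=
  exists N : int, forall p q, A (p, q) != 0 -> N <= p /\ N <= q.

(* [A(x2 + x0, x2)], indexed by the exponents of [(x0, x2)]. *)
Definition expand_add (W : lmodType F) (A : int * int ->
  W) (g : int * int) : W :=
  fsum (fun p => binzZ p g.1 *: A (p, g.2 + g.1 - p)).

Lemma subst_addE (W : lmodType F) (A : int -> int -> W) m n :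
  subst_add A m n = expand_add (fun g => A g.1 g.2) (m, n).
Proof.
by case: m => [m|m] //=; rewrite /expand_add fsum0// => p; rewrite scale0r.
Qed.

Lemma expand_add_finsupp (W : lmodType F) (A : int * int -> W) g : laurent2 A ->
  finsupp (fun p => binzZ p g.1 *: A (p, g.2 + g.1 - p)).
Proof.
move=> [N AN]; apply: (@finsupp_int _ _ N (g.2 + g.1 - N)) => p.
by rewrite scaler_eq0 negb_or => /andP[_ /AN[? ?]]; lia.
Qed.

Lemma expand_addD (W : lmodType F) (A B : int * int -> W) g : laurent2 A ->
  laurent2 B ->
  expand_add (fun g => A g + B g) g = expand_add A g + expand_add B g.
Proof.
move=> lA lB; rewrite /expand_add -fsumD; [|exact: expand_add_finsupp|exact:
  expand_add_finsupp].
by apply: eq_fsum => p; rewrite scalerDr.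
Qed.

(** Both sides sum one family [Phi ((i, l), (p, a))]: [(i, l)] is the exponent taken from [S], [p]
    the total exponent of [x1], and [a] the power of [x0] that comes from [S]. Summing over [a] by
    Vandermonde gives the left side; grouping by the exponents [(a, b)] of [S(x2 + x0, x2)] gives
    the right side. *)
Lemma expand_add_conv (W : lmodType F) (S : int * int -> F) (A : int * int ->
  W) :
  laurent2 S -> laurent2 A -> expand_add (conv S A) =1 conv (expand_add (S : _
    -> F^o)) (expand_add A).
Proof.
move=> [N SN] [M AM] [m n].
pose Phi (x : (int * int) * (int * int)) :=
  (binzZ x.1.1 x.2.2 * binzZ (x.2.1 - x.1.1) (m - x.2.2) * S x.1) *:
    A (x.2.1 - x.1.1, n + m - x.2.1 - x.1.2).
have PhiE i l p a : Phi ((i, l), (p, a)) != 0 ->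
  [/\ 0 <= a <= m, N <= i, N <= l,
    M <= p - i & M <= n + m - p - l].
  rewrite /Phi /= scaler_eq0 !mulf_eq0 !negb_or.
  move=> /andP[/andP[/andP[/binzZ_neq0 ? /binzZ_neq0 ?] /SN[? ?]] /AM[? ?]].
  by split; lia.
have Phifin : finsupp Phi.
  apply: (@finsupp_box2 _ _ N N (M + N) 0 (n + m - N - M - M) (n + m - N - M -
    M)
    (n + m - N - M) m) => i j k l /PhiE[*].
  by split; lia.
transitivity (fsum Phi).
  pose Psi (x : int * (int * int)) :=
    (binzZ x.1 m * S x.2) *: A (x.1 - x.2.1, n + m - x.1 - x.2.2).
  have Psifin : finsupp Psi.
    pose K := `|m| + `|n| + `|N| + `|M| + `|N| + `|M|.
    pose s := irange (- K) K; exists (allpairs pair s (allpairs pair s s)).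
    move=> [p [i l]]; rewrite /Psi scaler_eq0 mulf_eq0 !negb_or /=.
    move=> /andP[/andP[/binzZ_neq0 ? /SN[? ?]] /AM[? ?]].
    by apply: allpairs_f; last apply: allpairs_f; apply: mem_irange; lia.
  rewrite (fsum_pair Phifin).
  transitivity (fsum Psi); last rewrite fsum_pair_swap//.
    rewrite fsum_pair//; apply: eq_fsum => p; rewrite /conv fsum_scale.
      by apply: eq_fsum => h; rewrite /Psi /= scalerA.
    by have := finsupp_slice p Psifin; apply: sub_finsupp => h <-;
      rewrite /Psi /= scalerA.
  apply: eq_fsum => -[i l]; rewrite (fsum_pair (finsupp_slice _ Phifin)).
  apply: eq_fsum => p; rewrite /Phi /Psi /=.
  pose v := S (i, l) *: A (p - i, n + m - p - l).
  rewrite -scalerA -/v -[in LHS](subrKC i p) -vandermonde.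
  rewrite fsum_mulscale; last first.
    by apply: (sub_finsupp _ (vandermonde_fin F i (p - i) m)) => a ->;
      rewrite scale0r.
  by apply: eq_fsum => a; rewrite -scalerA.
pose h (x : (int * int) * (int * int)) :=
  ((x.2.1, x.1.2 + x.1.1 - x.2.1), (x.2.2 + x.2.1, x.1.1)).
pose h' (x : (int * int) * (int * int)) :=
  ((x.2.2, x.1.1 + x.1.2 - x.2.2), (x.1.1, x.2.1 - x.1.1)).
have hK : cancel h h'.
  by move=> [[a b] [i p]]; rewrite /h /h' /=; congr ((_, _), (_, _)); lia.
have h'K : cancel h' h.
  by move=> [[i l] [p a]]; rewrite /h /h' /=; congr ((_, _), (_, _)); lia.
have hfin := finsupp_comp hK Phifin.
rewrite (fsum_reindex _ hK h'K) fsum_pair//; apply: eq_fsum => -[a b] /=.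
have E i p : Phi (h ((a, b), (i, p))) =
  (binzZ i a * S (i, b + a - i)) *:
    (binzZ p (m - a) *: A (p, n - b + (m - a) - p)).
  rewrite /Phi /h /= !scalerA addrK.
  rewrite (_ : n + m - (p + i) - (b + a - i) = n - b + (m - a) - p);
    last by lia.
  by congr (_ *: _); ring.
have afin := finsupp_slice (a, b) hfin.
rewrite fsum_pair// /expand_add /= fsum_scalel; last first.
  apply: (@finsupp_int _ _ N (b + a - N)) => i; rewrite !scaler_eq0 !negb_or.
  by move=> /andP[/andP[_ /SN[? ?]] _]; lia.
apply: eq_fsum => i; rewrite fsum_scale; first by apply: eq_fsum => p;
  rewrite E.
by apply: (sub_finsupp _ (finsupp_slice i afin)) => p; rewrite E.
Qed.

(** The monomial [x^k]; thus [expand_sub (delta k)] is [(x1 - x2)^k], the factor used in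
    [mul_subX]. *)
Definition delta (k n : int) : F := (n == k)%:R.

(* [c(x0)] as a series in [(x0, x2)]. *)
Definition x0ser (c : int -> F) (g : int * int) : F :=
  if g.2 == 0 then c g.1 else 0.

Lemma conv_delta (G : zmodType) (W : lmodType F) (k : G) (A : G -> W) g :
  conv (fun h => (h == k)%:R) A g = A (g - k).
Proof.
rewrite /conv (@fsum_one _ _ k) ?eqxx ?scale1r// => h /negPf ->.
by rewrite scale0r.
Qed.

Lemma deltaD (k l : int) : conv (delta k) (delta l : _ -> F^o) =1 delta (k + l).
Proof. by move=> n; rewrite conv_delta /delta subr_eq addrC. Qed.

Lemma delta_ge (k n : int) : delta k n != 0 -> k <= n.
Proof. by rewrite /delta; case: (eqVneq n k) => [->//|_]; rewrite eqxx. Qed.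

Lemma expand_sub_deltaD (k l : nat) :
  conv (expand_sub (delta k)) (expand_sub (delta l) : _ ->
    F^o) =1 expand_sub (delta (k%:Z + l%:Z)).
Proof.
move=> g; rewrite (@conv_expand_sub _ _ _ 0); first by rewrite /expand_sub
  deltaD.
  by move=> n /delta_ge; lia.
by move=> n /delta_ge; lia.
Qed.

(** For [n >= 0] the power [(x1 - x2)^n] is a polynomial: its binomial coefficients vanish once the
    power of [x2] exceeds [n]. *)
Lemma expand_sub_ge0 (c : int -> F) : (forall n, c n != 0 -> 0 <= n) ->
  forall p q, expand_sub c (p, q) != 0 -> 0 <= p /\ 0 <= q.
Proof.
move=> c0 p q spq; have [cpq q0] := expand_sub_neq0 spq.
split=> //; move: spq; apply: contraR; rewrite -ltNge => p0.
have [k kE] : exists k : nat, p + q = k by exists `|(p + q)%R|%N;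
  have := c0 _ cpq; lia.
have [j jE] : exists j : nat, q = j by exists `|q|%N; lia.
rewrite /expand_sub /expand_sub_coef /= kE jE binzZ_nat bin_small ?mulr0
  ?mul0r//.
by lia.
Qed.

Lemma expand_sub_laurent2 (c : int -> F) : (forall n, c n != 0 -> 0 <= n) ->
  laurent2 (expand_sub c : _ -> F^o).
Proof. by move=> c0; exists 0; apply: expand_sub_ge0. Qed.

Lemma eq_expand_add (W : lmodType F) (A B : int * int -> W) : A =1 B ->
  expand_add A =1 expand_add B.
Proof. by move=> /funext ->. Qed.

Lemma delta_laurent2 (k : nat) : laurent2 (expand_sub (delta k) : _ -> F^o).
Proof. by apply: expand_sub_laurent2 => n /delta_ge; lia. Qed.

(* [(x2 + x0) - x2 = x0]; the [k]-th power follows by multiplicativity. *)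
Lemma expand_add_sub_delta (k : nat) (g : int * int) :
  expand_add (expand_sub (delta k) : _ -> F^o) g = (g == (k%:Z, 0))%:R.
Proof.
pose z : int := 0; elim: k g => [|k IH] [m n].
  rewrite /expand_add (@fsum_one _ _ z) /=; last first.
    rewrite /z => p p0; rewrite /expand_sub /expand_sub_coef /=.
    rewrite (_ : p + (n + m - p) = n + m); last by lia.
    rewrite /delta; case: (eqVneq (n + m) 0) => [E|_];
      last by rewrite mulr0 scaler0.
    by rewrite E add0r binzZ0l oppr_eq0 (negPf p0) mulr0 mul0r scaler0.
  rewrite /z binzZ0l subr0 /expand_sub /expand_sub_coef /= add0r /delta
    xpair_eqE.
  case: (eqVneq m 0) => [->|m0]; last by rewrite scale0r.
  rewrite addr0 scale1r; case: (eqVneq n 0) => [->|n0]; rewrite ?mulr0//.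
  by rewrite expr0z binzZ0 !mulr1.
have B1 x : binzZ 1 x = (x == 0)%:R + (x == 1)%:R.
  by have := binzZ_pascal F 0 x; rewrite add0r !binzZ0l subr_eq0.
have E1 g : expand_add (expand_sub (delta 1) : _ -> F^o) g = (g == (1, 0))%:R.
  case: g => {}m {}n.
  have D p q : p + q != 1 -> expand_sub (delta 1) (p, q) = 0.
    by rewrite /expand_sub /delta /= => /negPf ->; rewrite mulr0.
  rewrite /expand_add /=; case: (eqVneq (n + m) 1) => [nm|nm]; last first.
    rewrite fsum0 => [|p]; last by rewrite D ?scaler0//; lia.
    by case: eqP => // -[? ?]; lia.
  rewrite nm (@fsum_seq _ _ [:: (0 : int); (1 : int)])//; last first.
    move=> p; apply: contraR; rewrite !inE negb_or => /andP[p0 p1].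
    rewrite /expand_sub /expand_sub_coef /= subrKC.
    have p1' : (1 - p == 0 :> int) = false by lia.
    have p0' : (1 - p == 1 :> int) = false by lia.
    by rewrite B1 p1' p0' addr0 mulr0 mul0r scaler0.
  have S p q : p + q = 1 -> expand_sub (delta 1) (p, q) = (-1) ^ q * binzZ 1 q.
    by move=> pq; rewrite /expand_sub /expand_sub_coef /= pq /delta eqxx mulr1.
  have S0 : expand_sub (delta 1) (0, 1) = -1.
    by rewrite S ?add0r// B1 expr1z eqxx (_ : (1 == 0 :> int) = false)//
      add0r mulr1.
  have S1 : expand_sub (delta 1) (1, 0) = 1 by rewrite S ?addr0//
    binzZ0 expr0z mulr1.
  rewrite big_cons big_seq1 subr0 subrr S0 S1 binzZ0l B1 /GRing.scale /=.
  rewrite mulr1 mulrN1 addKr xpair_eqE.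
  case: (eqVneq m 1) nm => [->|m1] nm /=; first by rewrite (_ : n = 0)//; lia.
  by [].
have -> : Posz k.+1 = 1%N%:Z + k%:Z by lia.
rewrite -(eq_expand_add (expand_sub_deltaD 1 k)) expand_add_conv;
  try exact: delta_laurent2.
rewrite (_ : expand_add (expand_sub (delta 1%N) : _ ->
  F^o) = fun g => (g == (1, 0))%:R); last first.
  exact: funext E1.
rewrite conv_delta IH; congr (_%:R); congr nat_of_bool; rewrite !xpair_eqE /=.
by apply/andP/andP => -[/eqP ? /eqP ?]; split; apply/eqP; lia.
Qed.

(** The substitution preserves total degree, so the coefficient of [x0^m x2^n] sees only the term of
    degree [n + m] of [c], and the monomial case applies. *)
Lemma expand_add_sub (c : int -> F) : (forall n, c n != 0 -> 0 <= n) ->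
  expand_add (expand_sub c : _ -> F^o) =1 x0ser c.
Proof.
move=> c0 [m n].
have -> : expand_add (expand_sub c : _ -> F^o) (m, n) =
    c (n + m) * expand_add (expand_sub (delta (n + m)) : _ -> F^o) (m, n).
  rewrite /expand_add -[RHS]/(_ *: (_ : F^o)) fsum_scale.
    apply: eq_fsum => p; rewrite /expand_sub /= subrKC /delta eqxx mulr1
      /GRing.scale /=.
    by ring.
  apply: (@finsupp_int _ _ 0 (n + m)) => p; rewrite !scaler_eq0 !negb_or /=.
  move=> /and3P[cnm /binzZ_neq0 m0 /=]; have := c0 _ cnm => nm0.
  have [k kE] : exists k : nat, n + m = k by exists `|(n + m)%R|%N; lia.
  have dk l : delta k l != 0 -> 0 <= l by move=> /delta_ge; lia.
  have := @expand_sub_ge0 (delta k) dk p (n + m - p).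
  rewrite /expand_sub mulf_eq0 negb_or -kE => spq /spq[? ?]; lia.
rewrite /x0ser /=; have [E|/c0 nm0] := eqVneq (c (n + m)) 0.
  by rewrite E mul0r; case: eqVneq E => // -> <-; rewrite add0r.
have [k kE] : exists k : nat, n + m = k by exists `|(n + m)%R|%N; lia.
rewrite kE expand_add_sub_delta xpair_eqE; case: (eqVneq n 0) => [n0|n0].
  by rewrite -kE n0 add0r eqxx mulr1.
by rewrite andbF mulr0.
Qed.

Lemma mul_subXE (W : lmodType F) k (A : int -> int -> W) p q :
  mul_subX k A p q = conv (expand_sub (delta k)) (fun g => A g.1 g.2) (p, q).
Proof.
have S b : expand_sub (delta k) (k%:Z - b, b) = (-1) ^ b * binzZ k b.
  by rewrite /expand_sub /expand_sub_coef /= subrK /delta eqxx mulr1.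
rewrite /conv (@fsum_seq _ _ [seq (k%:Z - i%:Z, i%:Z) | i <- iota 0 k.+1]).
- rewrite big_map -[iota 0 _]/(index_iota 0 k.+1) big_mkord.
  apply: eq_bigr => i _; rewrite S binzZ_nat /=.
  by congr (_ *: A _ _); have := ltn_ord i; lia.
- by rewrite map_inj_uniq ?iota_uniq// => i j [].
move=> [a b]; rewrite scaler_eq0 negb_or => /andP[Sab _].
have dk l : delta k l != 0 -> 0 <= l by move=> /delta_ge; lia.
have [a0 b0] := expand_sub_ge0 dk Sab.
have [] := expand_sub_neq0 Sab; rewrite /delta; case: (eqVneq (a + b) k);
  last by rewrite eqxx.
move=> ab _ _; apply/mapP; exists `|b|%N; first by rewrite mem_iota; lia.
by congr (_, _); lia.
Qed.
End SubstAdd.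

(** * Spaces of two-variable series and the association relation *)

Section TwoVariables.
Variable F : numFieldType.

(* [W((x1))((x2))] *)
Definition L12 (W : zmodType) (A : int * int -> W) : Prop :=
  exists N : int, forall Q, exists M : int,
    forall p q, A (p, q) != 0 -> N <= q /\ (q <= Q -> M <= p).

Definition swap (g : int * int) : int * int := (g.2, g.1).

Lemma laurent2_L12 (W : zmodType) (A : int * int -> W) : laurent2 A -> L12 A.
Proof. by move=> [N AN]; exists N => Q; exists N => p q /AN[]. Qed.

Lemma expand_sub_L12 (c : int -> F) N : (forall n, c n != 0 -> N <= n) ->
  L12 (expand_sub c : _ -> F^o).
Proof.
move=> cN; exists 0 => Q; exists (N - Q) => p q /expand_sub_neq0[/cN ? ?].
by split => // ?; lia.
Qed.

Lemma fsum_neq0 (W : zmodType) (I : choiceType) (f : I -> W) :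
  fsum f != 0 -> exists i, f i != 0.
Proof.
move=> f0; apply: contrapT => /forallNP nf; move: f0;
  rewrite fsum0 ?eqxx// => i.
by apply/eqP/negP => /negP /nf.
Qed.

Lemma conv_neq0 (G : zmodType) (W : lmodType F) (S : G -> F) (A : G -> W) g :
  conv S A g != 0 -> exists h, S h != 0 /\ A (g - h) != 0.
Proof.
move=> /fsum_neq0[h]; rewrite scaler_eq0 negb_or => /andP[? ?].
by exists h.
Qed.

Lemma L12_conv (W : lmodType F) (S : int * int -> F) (A : int * int -> W) :
  L12 (S : _ -> F^o) -> L12 A -> L12 (conv S A).
Proof.
move=> [N SN] [N' AN]; exists (N + N') => Q.
have [M SM] := SN (Q - N'); have [M' AM] := AN (Q - N).
exists (M + M') => p q /conv_neq0[[i j] [/SM[? SM'] /AM /= [? AM']]].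
split; first by lia.
by move=> ?; have := SM' _; have := AM' _; lia.
Qed.

Lemma laurent2_conv (W : lmodType F) (S : int * int -> F) (A : int * int -> W) :
  laurent2 (S : _ -> F^o) -> laurent2 A -> laurent2 (conv S A).
Proof.
move=> [N SN] [N' AN]; exists (N + N') => p q /conv_neq0[[i j] [/SN[? ?] /AN /=
  [? ?]]].
by split; lia.
Qed.

(** The three exponents of [x2] are bounded below and have a fixed sum, so they are bounded above
    too; this in turn bounds each exponent of [x1] below, and the fixed sum bounds them above. *)
Lemma L12_finsupp (W : lmodType F) (S T : int * int -> F) (A : int * int ->
  W) g :
  L12 (S : _ -> F^o) -> L12 (T : _ -> F^o) -> L12 A ->
  finsupp (fun hk : (int * int) * (int * int) =>
    S hk.1 *: (T hk.2 *: A (g - hk.1 - hk.2))).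
Proof.
case: g => p q [N1 H1] [N2 H2] [N3 H3].
have [M1 {}H1] := H1 (q - N2 - N3); have [M2 {}H2] := H2 (q - N1 - N3).
have [M3 {}H3] := H3 (q - N1 - N2).
apply: (@finsupp_box2 _ _ M1 N1 M2 N2 (p - M2 - M3) (q - N2 - N3) (p - M1 - M3)
  (q - N1 - N3)) => i j k l /=.
rewrite !scaler_eq0 !negb_or => /and3P[/H1[? h1] /H2[? h2] /H3 /= [? h3]].
have i1 : M1 <= i by apply: h1; lia.
have i2 : M2 <= k by apply: h2; lia.
have i3 : M3 <= p - i - k by apply: h3; lia.
by split; lia.
Qed.

(** The version for iterates: in the variables [(x0, x2)] expansions go in nonnegative powers of the
    variable listed first, so the roles are exchanged. *)
Lemma L21_finsupp (W : lmodType F) (S T : int * int -> F) (A : int * int ->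
  W) g :
  L12 (S \o swap : _ -> F^o) -> L12 (T \o swap : _ -> F^o) -> L12 (A \o swap) ->
  finsupp (fun hk : (int * int) * (int * int) =>
    S hk.1 *: (T hk.2 *: A (g - hk.1 - hk.2))).
Proof.
move=> lS lT lA; have := L12_finsupp (swap g) lS lT lA.
pose h (x : (int * int) * (int * int)) := (swap x.1, swap x.2).
have hK : cancel h h by move=> [[? ?] [? ?]].
move=> /(finsupp_comp hK); apply: sub_finsupp => -[[i j] [k l]].
by rewrite /= /swap /=; case: g.
Qed.

Lemma conv_shiftr (G : zmodType) (W : lmodType F) (S : G -> F) (A : G ->
  W) k g :
  conv S (fun h => A (h - k)) g = conv S A (g - k).
Proof. by apply: eq_fsum => h; rewrite addrAC. Qed.

Lemma conv_shiftl (G : zmodType) (W : lmodType F) (S : G -> F) (A : G ->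
  W) k g :
  conv (fun h => S (h - k)) A g = conv S A (g - k).
Proof.
rewrite /conv (fsum_reindex (h := fun h => h + k) (h' := fun h => h - k)).
- by apply: eq_fsum => h; rewrite addrK opprD addrA addrAC.
- by move=> h; rewrite addrK.
- by move=> h; rewrite subrK.
Qed.

Lemma eq_convl (G : zmodType) (W : lmodType F) (S T : G -> F) (A : G -> W) :
  S =1 T -> conv S A = conv T A.
Proof. by move=> /funext ->. Qed.

Lemma eq_convr (G : zmodType) (W : lmodType F) (S : G -> F) (A B : G -> W) :
  A =1 B -> conv S A = conv S B.
Proof. by move=> /funext ->. Qed.

Notation P k := (expand_sub (@delta F k%:Z)).

Lemma P_bound (k : nat) p q : P k (p, q) != 0 ->
  [/\ 0 <= p <= k%:Z, 0 <= q <= k%:Z & p + q = k].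
Proof.
have dk l : @delta F k l != 0 -> 0 <= l by move=> /delta_ge; lia.
move=> Pk; have [? ?] := expand_sub_ge0 dk Pk; have [] := expand_sub_neq0 Pk.
by rewrite /delta; case: (eqVneq (p + q) k) => [|_]; [split; lia|rewrite eqxx].
Qed.

Lemma P_finsupp (W : lmodType F) k (A : int * int -> W) g :
  finsupp (fun h => P k h *: A (g - h)).
Proof.
apply: (@finsupp_box _ _ 0 k 0 k) => i j; rewrite scaler_eq0 negb_or.
by move=> /andP[/P_bound[? ? ?] _]; split; lia.
Qed.

Lemma P_conv (W : lmodType F) k l (A : int * int -> W) :
  conv (P (k + l)%N) A =1 conv (P k) (conv (P l) A).
Proof.
move=> g; rewrite conv_assoc; last first.
  apply: (@finsupp_box2 _ _ 0 0 0 0 k k l l) => a b c d.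
  rewrite !scaler_eq0 !negb_or => /and3P[/P_bound[? ? ?] /P_bound[? ? ?] _].
  by split; lia.
by rewrite (eq_convl _ (@expand_sub_deltaD F k l)).
Qed.

(* The relation between a product [A(x1, x2)] of two vertex operators and the
   iterate [B(x0, x2)] that weak associativity asserts. *)
Definition associated (W : lmodType F) (k : nat) (A B : int * int ->
  W) : Prop :=
  laurent2 (conv (P k) A) /\
  forall m n, expand_add (conv (P k) A) (m, n) = B (m - k%:Z, n).

Lemma expand_add_delta_conv (W : lmodType F) l (A : int * int ->
  W) g : laurent2 A ->
  expand_add (conv (P l) A) g = expand_add A (g - (l%:Z, 0)).
Proof.
move=> lA; rewrite expand_add_conv//; last exact: delta_laurent2.
by rewrite (eq_convl _ (@expand_add_sub_delta F l)) conv_delta.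
Qed.

Lemma associated_mono (W : lmodType F) k l (A B : int * int -> W) :
  associated k A B -> associated (l + k)%N A B.
Proof.
move=> [lA AB]; have E : conv (P (l + k)%N) A = conv (P l) (conv (P k) A).
  exact: funext (P_conv l k A).
split; rewrite E.
  by apply: laurent2_conv => //; apply: delta_laurent2.
move=> m n; rewrite expand_add_delta_conv//= AB; congr (B (_, _));
  rewrite /= ?subr0//; lia.
Qed.

Lemma laurent2D (W : zmodType) (A B : int * int -> W) : laurent2 A ->
  laurent2 B ->
  laurent2 (fun g => A g + B g).
Proof.
move=> [N AN] [M BM]; exists (- (`|N| + `|M|)) => p q nz.
have [A0|/AN[? ?]] := eqVneq (A (p, q)) 0; last by lia.
by move: nz; rewrite A0 add0r => /BM[? ?]; lia.
Qed.

Lemma associatedD (W : lmodType F) k (A B A' B' : int * int -> W) :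
  associated k A B -> associated k A' B' ->
  associated k (fun g => A g + A' g) (fun g => B g + B' g).
Proof.
move=> [lA AB] [lA' AB'].
have E : conv (P k) (fun g => A g + A' g) = fun g =>
  conv (P k) A g + conv (P k) A' g.
  apply: funext => g; rewrite /conv -fsumD; [|exact: P_finsupp|exact:
    P_finsupp].
  by apply: eq_fsum => h; rewrite scalerDr.
split; rewrite E; first exact: laurent2D.
by move=> m n; rewrite expand_addD// AB AB'.
Qed.

Lemma associated0 (W : lmodType F) k :
  associated k (fun=> 0 : W) (fun=> 0 : W).
Proof.
have E : conv (P k) (fun=> 0 : W) = fun=> 0.
  by apply: funext => g; apply: fsum0 => h; rewrite scaler0.
split; rewrite E; first by exists 0 => p q; rewrite eqxx.
by move=> m n; apply: fsum0 => p; rewrite scaler0.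
Qed.

(** The order of quantifiers is the point: [x] will be the vector acted on, and one [k] must serve
    all of them. Extra factors [x1 - x2] are harmless, so the exponents of the summands are simply
    added. *)
Lemma associated_sum (W : lmodType F) (J X : Type) (r : seq J)
    (A B : J -> X -> int * int -> W) :
  (forall j, exists k, forall x, associated k (A j x) (B j x)) ->
  exists k, forall x, associated k (fun g => \sum_(j <- r) A j x g)
    (fun g => \sum_(j <- r) B j x g).
Proof.
move=> AB; elim: r => [|j r [k IH]].
  exists 0%N => x; have := associated0 W 0.
  by congr associated; apply: funext => g; rewrite big_nil.
have [l ABj] := AB j; exists (l + k)%N => x.
have h1 := associated_mono k (ABj x); rewrite addnC in h1.
have := associatedD h1 (associated_mono l (IH x)).
congr associated; apply: funext => g.
  by rewrite big_cons.
by rewrite big_cons.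
Qed.

Lemma x0ser_shift (c : int -> F) (l : int) :
  x0ser (fun n => c (n - l)) =1 fun g => x0ser c (g - (l, 0)).
Proof. by move=> [m n]; rewrite /x0ser /= subr0. Qed.

(** The factor [(x1 - x2)^l] clears the pole of [c], the factor [(x1 - x2)^k] makes [A] bounded
    below in both variables, and [E] is so already. The substitution is then multiplicative on the
    three factors, and the two powers turn into shifts by [l] and [k] in [x0]. *)
Lemma associated_conv (W : lmodType F) k l (c : int -> F) (E : int * int -> F)
    (A B : int * int -> W) :
  (forall n, c n != 0 -> - l%:Z <= n) -> laurent2 (E : _ -> F^o) -> L12 A ->
  associated k A B ->
  associated (l + k)%N (conv (expand_sub c) (conv E A))
    (conv (x0ser c) (conv (expand_add (E : _ -> F^o)) B)).
Proof.
move=> cl lE lA [lPA AB].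
have lP j : L12 (P j : _ -> F^o) by apply/laurent2_L12/delta_laurent2.
have lc := expand_sub_L12 cl; have lE' := laurent2_L12 lE.
have lEA := L12_conv lE' lA.
pose d n := c (n - l%:Z).
have d0 n : d n != 0 -> 0 <= n by move=> /cl; lia.
(* Regrouping is legitimate since all factors lie in [L12]. The series [d] is [x^l c(x)], a power
   series. *)
have Eq : conv (P (l + k)%N) (conv (expand_sub c) (conv E A)) =
    conv (expand_sub d) (conv E (conv (P k) A)).
  apply: funext => g; rewrite P_conv.
  rewrite (eq_convr _ (fun g => conv_comm (L12_finsupp g (lP k) lc lEA))).
  have -> : conv (P k) (conv E A) = conv E (conv (P k) A).
    exact: funext (fun g => conv_comm (L12_finsupp g (lP k) lE' lA)).
  rewrite (conv_assoc (L12_finsupp g (lP l) lc _)); last first.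
    by apply: L12_conv => //; apply: L12_conv.
  congr (conv _ _ g); apply: funext => h; rewrite (@conv_expand_sub _ _ _ (-
    l%:Z))//.
    by rewrite /expand_sub conv_delta.
  by move=> n /delta_ge; lia.
have ld := expand_sub_laurent2 d0.
split; rewrite Eq; first by do 2!apply: laurent2_conv => //.
move=> m n; rewrite expand_add_conv//; last exact: laurent2_conv.
rewrite (eq_convl _ (expand_add_sub d0)) (eq_convr _ (expand_add_conv lE lPA)).
rewrite (eq_convl _ (x0ser_shift c l)) conv_shiftl.
have -> : expand_add (conv (P k) A) = fun g => B (g - (k%:Z, 0)).
  by apply: funext => -[i j]; rewrite AB -[in LHS](subr0 j).
rewrite (eq_convr _ (conv_shiftr _ B (k%:Z, 0))) conv_shiftr.
have -> : (m - (l + k)%N%:Z, n) = (m, n) - (l%:Z, 0) - (k%:Z, 0) :> (int *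
  int)%type.
  by rewrite -[n in LHS](subr0 n) -[n - 0 in LHS]subr0 PoszD opprD addrA.
by [].
Qed.

End TwoVariables.
(** * Products of vertex operators *)

Section Spans.
Variables (F : numFieldType) (W : lmodType F).

Definition laurent1 (V : zmodType) (c : int -> V) : Prop :=
  exists N : int, forall n, c n != 0 -> N <= n.

(* Finite sums of products of a scalar series and a fixed vector; as an
   inductive predicate it reduces statements additive in the series to
   series of the form [c(x) w]. *)
Inductive spanned (I : Type) (good : (I -> F) -> Prop) : (I -> W) -> Prop :=
| spanned0 : spanned good (fun=> 0)
| spannedD c w f : good c -> spanned good f ->
    spanned good (fun i => c i *: w + f i).

Lemma in_laurentP (V : lmodType F) (f : int -> V) : in_laurent f <-> laurent1 f.
Proof.
split=> -[N fN]; exists N => n; last first.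
  by rewrite ltNge => nN; apply: contraNeq nN; apply: fN.
by apply: contraR; rewrite -ltNge => /fN ->.
Qed.

Lemma spanned_in_tensor_laurent (f : int -> W) :
  in_tensor_laurent f -> spanned (fun c => laurent1 (c : _ -> F^o)) f.
Proof.
move=> [r [w [c [lc fE]]]].
have -> : f = fun n => \sum_(i <- enum 'I_r) c i n *: w i.
  by apply: funext => n; rewrite fE big_enum.
elim: (enum 'I_r) => [|i s IH].
  have -> : (fun n => \sum_(i <- [::]) c i n *: w i) = fun=> 0.
    by apply: funext => n; rewrite big_nil.
  exact: spanned0.
have -> : (fun n => \sum_(j <- i :: s) c j n *: w j) =
    fun n => c i n *: w i + \sum_(j <- s) c j n *: w j.
  by apply: funext => n; rewrite big_cons.
by apply: spannedD => //; apply/in_laurentP.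
Qed.

Lemma spanned_add (I : Type) (good : (I -> F) -> Prop) (f g : I -> W) :
  spanned good f -> spanned good g -> spanned good (fun i => f i + g i).
Proof.
move=> sf sg; elim: sf => [|c w f' gc _ IH].
  by have -> : (fun i => 0 + g i) = g by apply: funext => i; rewrite add0r.
have -> : (fun i => c i *: w + f' i + g i) = fun i => c i *: w + (f' i + g i).
  by apply: funext => i; rewrite addrA.
exact: spannedD.
Qed.

Lemma spanned_laurent2 (f : int * int -> W) :
  spanned (fun c => laurent2 (c : _ -> F^o)) f -> laurent2 f.
Proof.
elim=> [|c w f' [N cN] _ lf]; first by exists 0 => p q; rewrite eqxx.
apply: laurent2D => //; exists N => p q; rewrite scaler_eq0 negb_or.
by move=> /andP[/cN].
Qed.

End Spans.

Section VertexMaps.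
Variable F : numFieldType.

Lemma vertex_linl (V W : lmodType F) (Y : V -> W -> int -> W) w n :
  is_vertex_map Y -> linear (fun v => Y v w n).
Proof. by move=> [/(_ n)[]]. Qed.

Lemma vertex_linr (V W : lmodType F) (Y : V -> W -> int -> W) v n :
  is_vertex_map Y -> linear (fun w => Y v w n).
Proof. by move=> [/(_ n)[_]]. Qed.

Lemma vertex_laurent1 (V W : lmodType F) (Y : V -> W -> int -> W) v w :
  is_vertex_map Y -> laurent1 (Y v w).
Proof. by move=> [_ /(_ v w)/in_laurentP]. Qed.

Section Linearity.
Variables (V W : lmodType F) (Y : V -> W -> int -> W).
Hypothesis vY : is_vertex_map Y.

Lemma vertex0l w n : Y 0 w n = 0. Proof. exact: lin0 (vertex_linl w n vY). Qed.

Lemma vertex0r v n : Y v 0 n = 0. Proof. exact: lin0 (vertex_linr v n vY). Qed.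

Lemma vertexDl u v w n : Y (u + v) w n = Y u w n + Y v w n.
Proof. exact: linD (vertex_linl w n vY) u v. Qed.

Lemma vertexDr v w w' n : Y v (w + w') n = Y v w n + Y v w' n.
Proof. exact: linD (vertex_linr v n vY) w w'. Qed.

Lemma vertexZl a v w n : Y (a *: v) w n = a *: Y v w n.
Proof. exact: linZ (vertex_linl w n vY) a v. Qed.

Lemma vertexZr a v w n : Y v (a *: w) n = a *: Y v w n.
Proof. exact: linZ (vertex_linr v n vY) a w. Qed.

End Linearity.

(** Expanding first [YW v w], then [YW u] on each of the finitely many vectors obtained, leaves
    products of a series in [x1] and a series in [x2]. Hence the product of the two operators is
    bounded below in both variables before any multiplication by [x1 - x2]. *)
Lemma spanned_iterate (V W : lmodType F) (YW : V -> W -> int -> W) u v w :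
  is_vertex_map YW -> (forall v w, in_tensor_laurent (YW v w)) ->
  spanned (fun c => laurent2 (c : _ -> F^o)) (fun g => YW u (YW v w g.2) g.1).
Proof.
move=> vY tY; have := spanned_in_tensor_laurent (tY v w);
  elim=> [|d w' f [M dM] _ IH].
  have -> : (fun g : int * int => YW u 0 g.1) = fun=> 0.
    by apply: funext => g; rewrite (vertex0r vY).
  exact: spanned0.
have -> : (fun g : int * int => YW u (d g.2 *: w' + f g.2) g.1) =
    fun g => d g.2 *: YW u w' g.1 + YW u (f g.2) g.1.
  by apply: funext => g; rewrite (vertexDr vY) (vertexZr vY).
apply: spanned_add => //.
have := spanned_in_tensor_laurent (tY u w'); elim=> [|c w'' f' [N cN] _ IH'].
  have -> : (fun g : int * int => d g.2 *: (0 : W)) = fun=> 0.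
    by apply: funext => g; rewrite scaler0.
  exact: spanned0.
have -> : (fun g : int * int => d g.2 *: (c g.1 *: w'' + f' g.1)) =
    fun g => (d g.2 * c g.1) *: w'' + d g.2 *: f' g.1.
  by apply: funext => g; rewrite scalerDr scalerA.
apply: spannedD => //; exists (- (`|N| + `|M|)) => p q /=.
by rewrite mulf_eq0 negb_or => /andP[/dM ? /cN ?]; split; lia.
Qed.

(** Each of the finitely many exponents [q] between [N] and [Q] gives one Laurent series in the
    other variable, so a common lower bound exists. This covers [Y(a, x1) Y(v, x2) w] and, with
    variables exchanged, [Y(Y(a, x0) v, x2) w]. *)
Lemma L12_iter (U W : lmodType F) (f : int -> U) (g : U -> int -> W) :
  laurent1 f -> (forall u, laurent1 (g u)) -> (forall n, g 0 n = 0) ->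
  L12 (fun x => g (f x.2) x.1).
Proof.
move=> [N fN] lg g0; exists N => Q.
have [M gM] : exists M, forall q p, N <= q <= Q -> g (f q) p != 0 -> M <= p.
  have [k kQ] : exists k : nat, Q < N + k%:Z by exists `|(Q - N + 1)%R|%N; lia.
  elim: k Q kQ => [|k IH] Q QN; first by exists 0 => q p; lia.
  have [|M gM] := IH (Q - 1); first by lia.
  have [M' gM'] := lg (f Q); exists (- (`|M| + `|M'|)) => q p qQ nz.
  have [E|qneQ] := eqVneq q Q; first by move: nz; rewrite E => /gM' ?; lia.
  by have := gM q p _ nz; lia.
exists M => p q /= nz; have qN : N <= q.
  by apply: fN; apply: contraNneq nz => ->; rewrite g0.
by split=> // qQ; apply: (gM q) => //; rewrite qN.
Qed.

Lemma associatedP (W : lmodType F) k (A : int -> int -> W) (B : int * int ->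
  W) :
  associated k (fun g => A g.1 g.2) B <-> in_laurent2 (mul_subX k A) /\
    forall m n, subst_add (mul_subX k A) m n = B (m - k%:Z, n).
Proof.
have E : (fun g : int * int => mul_subX k A g.1 g.2) =
    conv (expand_sub (@delta F k%:Z)) (fun g => A g.1 g.2).
  by apply: funext => -[p q]; rewrite mul_subXE.
split=> -[lA AB]; split.
- case: lA => N AN; exists N => p q; rewrite mul_subXE => pq.
  by apply: contraTeq pq => /AN[? ?]; lia.
- by move=> m n; rewrite subst_addE E AB.
- case: lA => N AN; exists N => p q; rewrite -mul_subXE => nz.
  by have [] : ~~ ((p < N) || (q < N)) by [apply: contraNN nz => /AN ->]; lia.
- by move=> m n; rewrite -E -AB subst_addE.
Qed.

End VertexMaps.

(** * Weak associativity for products with an inserted series in [x1 - x2] *)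

Section MixedProducts.
Variables (F : numFieldType) (V : lmodType F) (Y : V -> V -> int -> V).
Hypothesis vY : is_vertex_map Y.
Hypothesis aY : weakly_associative Y Y.

(* [Y(a, x1) Y(f(x1 - x2), x2) G(x1, x2)] *)
Definition prod_term a (f : int -> V) (G : int * int -> V) (g : int * int)
    (x : (int * int) * (int * int)) : V :=
  Y a (Y (expand_sub_coef F x.1 *: f (x.1.1 + x.1.2)) (G x.2) (g.2 - x.1.2 -
    x.2.2))
    (g.1 - x.1.1 - x.2.1).

(* [Y(Y(a, x0) f(x0), x2) G(x0, x2)] *)
Definition iter_term a (f : int -> V) (G : int * int -> V) (g : int * int)
    (x : (int * int) * (int * int)) : V :=
  Y (Y a (if x.1.2 == 0 then f x.1.1 else 0) (g.1 - x.1.1 - x.2.1)) (G x.2)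
    (g.2 - x.1.2 - x.2.2).

(** Finiteness is part of the notion because [fsum] is additive only on finite supports; it has to
    be carried through the inductions on the spans of [f] and [G]. *)
Definition prod_assoc k a f G : Prop :=
  [/\ forall g, finsupp (prod_term a f G g),
      forall g, finsupp (iter_term a f (expand_add G) g) &
      associated k (fun g => fsum (prod_term a f G g))
        (fun g => fsum (iter_term a f (expand_add G) g))].

Lemma prod_assoc0 k a f G : (forall g x, prod_term a f G g x = 0) ->
  (forall g x, iter_term a f (expand_add G) g x = 0) -> prod_assoc k a f G.
Proof.
move=> p0 i0; split=> [g|g|]; try exact: finsupp0.
have := associated0 V k; congr associated; apply: funext => g; apply/esym/fsum0.
  exact: p0.
exact: i0.
Qed.

Lemma prod_assocD k a f G f1 G1 f2 G2 :
  (forall g x, prod_term a f G g x = prod_term a f1 G1 g x + prod_term a f2 G2 g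
    x) ->
  (forall g x, iter_term a f (expand_add G) g x =
    iter_term a f1 (expand_add G1) g x + iter_term a f2 (expand_add G2) g x) ->
  prod_assoc k a f1 G1 -> prod_assoc k a f2 G2 -> prod_assoc k a f G.
Proof.
move=> pD iD [fp1 fi1 A1] [fp2 fi2 A2].
have pE g : prod_term a f G g = fun x => prod_term a f1 G1 g x + prod_term a f2
  G2 g x.
  exact: funext.
have iE g : iter_term a f (expand_add G) g = fun x =>
    iter_term a f1 (expand_add G1) g x + iter_term a f2 (expand_add G2) g x.
  exact: funext.
split=> [g|g|]; [by rewrite pE; apply: finsuppD|by rewrite iE;
  apply: finsuppD|].
have := associatedD A1 A2; congr associated; apply: funext => g.
  by rewrite -fsumD// pE.
by rewrite -fsumD// iE.
Qed.

Lemma prod_assoc_mono k l a f G : prod_assoc k a f G ->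
  prod_assoc (l + k)%N a f G.
Proof. by move=> [? ? ?]; split=> //; apply: associated_mono. Qed.

(** The generators of both spans: by bilinearity the scalar series leave the operators, and
    [associated_conv] applies to what remains. *)
Lemma prod_assoc_scalar a v (c : int -> F) l k (E : int * int -> F) w :
  (forall n, c n != 0 -> - l%:Z <= n) -> laurent2 (E : _ -> F^o) ->
  associated k (fun g => Y a (Y v w g.2) g.1) (fun g => Y (Y a v g.1) w g.2) ->
  prod_assoc (l + k)%N a (fun n => c n *: v) (fun g => E g *: w).
Proof.
move=> cl lE AB.
set A : int * int -> V := fun g => Y a (Y v w g.2) g.1 in AB.
set B : int * int -> V := fun g => Y (Y a v g.1) w g.2 in AB.
have lA : L12 A.
  apply: (L12_iter (f := Y v w) (g := fun u => Y a u)) => [|u|n].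
  - exact: vertex_laurent1.
  - exact: vertex_laurent1.
  - exact: vertex0r vY _ n.
have lB : L12 (B \o swap).
  apply: (L12_iter (f := Y a v) (g := fun u => Y u w)) => [|u|n].
  - exact: vertex_laurent1.
  - exact: vertex_laurent1.
  - exact: vertex0l vY _ n.
have pE g x : prod_term a (fun n => c n *: v) (fun g => E g *: w) g x =
    expand_sub c x.1 *: (E x.2 *: A (g - x.1 - x.2)).
  rewrite /prod_term /A /expand_sub /=.
  do 2![rewrite (vertexZl vY) !(vertexZr vY)]; rewrite !scalerA.
  by congr (_ *: _); ring.
have sE : expand_add (fun g => E g *: w) = fun g => expand_add (E : _ ->
  F^o) g *: w.
  apply: funext => g; rewrite /expand_add fsum_scalel; last first.
    apply: (sub_finsupp _ (expand_add_finsupp g lE)) => p.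
    by move=> ->; rewrite scale0r.
  by apply: eq_fsum => p; rewrite scalerA.
have iE g x : iter_term a (fun n => c n *: v) (expand_add (fun g =>
  E g *: w)) g x =
    x0ser c x.1 *: (expand_add (E : _ -> F^o) x.2 *: B (g - x.1 - x.2)).
  rewrite /iter_term /B /= sE (vertexZr vY) /x0ser.
  case: eqP => _.
    rewrite (vertexZr vY) (vertexZl vY).
    by rewrite !scalerA mulrC.
  rewrite (vertex0r vY) (vertex0l vY).
  by rewrite scaler0 scale0r.
have lc := expand_sub_L12 cl.
have lx : L12 (x0ser c \o swap : _ -> F^o).
  exists (- l%:Z) => Q; exists 0 => p q; rewrite /x0ser /=.
  by case: (eqVneq p 0) => [-> /cl ?|_]; [split|rewrite eqxx].
(* [E(x2 + x0, x2)] has only nonnegative powers of [x0], and its total degree is at least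
   [N + N]. *)
have ls : L12 (expand_add (E : _ -> F^o) \o swap).
  case: lE => N EN; exists 0 => Q; exists (N + N - Q) => p q /=.
  rewrite /expand_add /swap /= => nz; case: (@fsum_neq0 F^o _ _ nz) => i.
  rewrite scaler_eq0 negb_or => /andP[/binzZ_neq0 q0 /EN[? ?]].
  by split=> // ?; lia.
have pf g : finsupp (fun x => expand_sub c x.1 *: (E x.2 *: A (g - x.1 - x.2))).
  by apply: L12_finsupp => //; apply: laurent2_L12.
have iF g : finsupp (fun x => x0ser c x.1 *: (expand_add (E : _ ->
  F^o) x.2 *: B (g - x.1 - x.2))).
  exact: L21_finsupp.
split=> [g|g|].
- by rewrite (funext (pE g)).
- by rewrite (funext (iE g)).
have := associated_conv cl lE lA AB; congr associated; apply: funext => g.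
  by rewrite conv_convE// (funext (pE g)).
by rewrite conv_convE// (funext (iE g)).
Qed.

(** Here [k] is chosen before [G], the only part that will involve [w]. It collects, over the terms
    [c(x) v] of [f], the pole order of [c] and the exponent of weak associativity for [a] and [v];
    so the induction on [f] is outside the one on [G]. *)
Lemma prod_assoc_spanned a f : spanned (fun c => laurent1 (c : _ -> F^o)) f ->
  exists k, forall G, spanned (fun c => laurent2 (c : _ -> F^o)) G ->
    prod_assoc k a f G.
Proof.
elim=> [|c v f' [N cN] _ [k1 IH]].
  exists 0%N => G sG; apply: prod_assoc0 => g x.
    by rewrite /prod_term scaler0 (vertex0l vY) (vertex0r vY).
  by rewrite /iter_term if_same (vertex0r vY) (vertex0l vY).
have [k2 kP] := aY a v; pose l := `|N|%N.
have cl n : c n != 0 -> - l%:Z <= n by move=> /cN; lia.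
exists (k1 + (l + k2))%N => G sG.
apply: (@prod_assocD _ _ _ _ (fun n => c n *: v) G f' G).
- move=> g x; rewrite /prod_term scalerDr (vertexDl vY).
  by rewrite (vertexDr vY).
- move=> g x; rewrite /iter_term -(vertexDl vY).
  rewrite -(vertexDr vY).
  by case: eqP; rewrite ?addr0.
- apply: prod_assoc_mono; elim: sG => [|E w G' lE sG' IHG].
    have s0 : expand_add (fun=> 0 : V) = fun=> 0.
      by apply: funext => g; apply: fsum0 => p; rewrite scaler0.
    apply: prod_assoc0 => g x.
      by rewrite /prod_term !(vertex0r vY).
    by rewrite /iter_term s0 (vertex0r vY).
  apply: (prod_assocD (f1 := fun n => c n *: v) (G1 :=
    fun g => E g *: w) _ _ _ IHG).
  + move=> g x; rewrite /prod_term (vertexDr vY).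
    by rewrite (vertexDr vY).
  + move=> g x; rewrite /iter_term expand_addD ?(vertexDr vY)//.
      case: lE => M EM; exists M => p q; rewrite scaler_eq0 negb_or.
      by move=> /andP[/EM].
    exact: spanned_laurent2.
  + apply: prod_assoc_scalar => //.
    exact: (iffRL (associatedP k2 (iterate Y a v w) (fun g =>
      Y (Y a v g.1) w g.2))).
- by rewrite addnC; apply: prod_assoc_mono; apply: IH.
Qed.

End MixedProducts.
(** * The deformed vertex algebra *)

Section LinearForms.
Variable F : fieldType.

Lemma sum_linear (U W : lmodType F) (I : Type) (r : seq I) (f : I -> U -> W) :
  (forall i, linear (f i)) -> linear (fun u => \sum_(i <- r) f i u).
Proof.
move=> lf a u v; rewrite scaler_sumr -big_split; apply: eq_bigr => i _.
exact: lf.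
Qed.

Lemma fsum_linear (U W : lmodType F) (I : choiceType) (f : I -> U -> W) :
  (forall i, linear (f i)) -> (forall u, finsupp (f^~ u)) ->
  linear (fun u => fsum (f^~ u)).
Proof.
move=> lf ff a u v.
have fa : finsupp (fun i => a *: f i u) by apply: sub_finsupp (ff u) => i ->;
  rewrite scaler0.
rewrite fsum_scale// -fsumD//; apply: eq_fsum => i; exact: lf.
Qed.

Lemma tsum_linear_fun (U V V' W : lmodType F) (t : tensor V V')
    (B : U -> V -> V' -> W) :
  (forall v w, linear (fun u => B u v w)) -> linear (fun u => tsum t (B u)).
Proof. by move=> lB; apply: sum_linear. Qed.

Lemma tpure0l (U V : lmodType F) (v : V) : (0 : U) \ot v = 0.
Proof. by have [/(_ v)/lin0] := tpure_bilinear U V. Qed.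

Lemma tpure0r (U V : lmodType F) (u : U) : u \ot (0 : V) = 0.
Proof. by have [_ /(_ u)/lin0] := tpure_bilinear U V. Qed.

Lemma tsum_lin (U V W : lmodType F) (B : U -> V -> W) (I : Type) (r : seq I)
    (f : I -> tensor U V) : bilinear_map B ->
  tsum (\sum_(i <- r) f i) B = \sum_(i <- r) tsum (f i) B.
Proof. by move=> bB; rewrite (lin_sum (tsum_linear bB)). Qed.

Lemma tsum_tmap (U V U' V' W : lmodType F) (f : U -> U') (g : V -> V')
    (B : U' -> V' -> W) (t : tensor U V) : bilinear_map B ->
  tsum (tmap f g t) B = tsum t (fun u v => B (f u) (g v)).
Proof.
move=> bB; rewrite [tmap f g t](_ : _ = \sum_(p <- repr t) f p.1 \ot g p.2)//
  tsum_lin//; apply: eq_bigr => p _.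
exact: tsum_pure.
Qed.

Lemma tsum_tswap (U V W : lmodType F) (B : V -> U -> W) (t : tensor U V) :
  bilinear_map B -> tsum (tswap t) B = tsum t (fun u v => B v u).
Proof.
move=> bB; rewrite [tswap t](_ : _ = \sum_(p <- repr t) p.2 \ot p.1)//
  tsum_lin//; apply: eq_bigr => p _.
exact: tsum_pure.
Qed.

Lemma tsum_tassoc (U V V' W : lmodType F) (B : U -> V -> V' -> W)
    (t : tensor (tensor U V) V') :
  (forall v v', linear (fun u => B u v v')) ->
  (forall u, bilinear_map (B u)) ->
  tsum (tassoc t) (fun u y => tsum y (B u)) =
  tsum t (fun y v' => tsum y (fun u v => B u v v')).
Proof.
move=> lB bB.
have bT : bilinear_map (fun u y => tsum y (B u)).
  by split=> [y|u]; [apply: tsum_linear_fun|apply: tsum_linear].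
rewrite [tassoc t](_ : _ = \sum_(p <- repr t) \sum_(q <- repr p.1)
  q.1 \ot (q.2 \ot p.2))// tsum_lin//; apply: eq_bigr => p _.
rewrite tsum_lin//; apply: eq_bigr => q _.
by rewrite !tsum_pure.
Qed.

End LinearForms.

(** * Existence of products in a single variable *)

Section Products.
Variable F : numFieldType.

(** The reason why the deformed operator exists. For an arbitrary Laurent series [f] the lower bound
    of [Y u (f n)] could drop as [n] grows, making the coefficients of [Y(u, x) f(x)] infinite sums;
    when [f] involves finitely many vectors one bound serves all [n]. *)
Lemma laurent2_apply (V : lmodType F) (Y : V -> V -> int -> V) u f :
  is_vertex_map Y -> spanned (fun c => laurent1 (c : _ -> F^o)) f ->
  laurent2 (fun x => Y u (f x.1) x.2).
Proof.
move=> vY; elim=> [|c w f' [N cN] _ lf].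
  by exists 0 => p q; rewrite (vertex0r vY) eqxx.
have -> : (fun x : int * int => Y u (c x.1 *: w + f' x.1) x.2) =
    fun x => c x.1 *: Y u w x.2 + Y u (f' x.1) x.2.
  by apply: funext => x; rewrite (vertexDr vY) (vertexZr vY).
apply: laurent2D => //; have [M YM] := vertex_laurent1 u w vY.
exists (- (`|N| + `|M|)) => p q /=; rewrite scaler_eq0 negb_or.
by move=> /andP[/cN ? /YM ?]; split; lia.
Qed.

Lemma apply_finsupp (V : lmodType F) (Y : V -> V -> int -> V) u f n :
  is_vertex_map Y -> spanned (fun c => laurent1 (c : _ -> F^o)) f ->
  finsupp (fun j => Y u (f j) (n - j)).
Proof.
move=> vY /(laurent2_apply u vY)[N YN].
by apply: (@finsupp_int _ _ N (n - N)) => j /(YN (j, n - j).1 (j, n - j).2)[/= ?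
  ?]; lia.
Qed.

Lemma series_tensor_finsupp (U V : lmodType F) (f : int -> U) (g : int -> V) n :
  laurent1 f -> laurent1 g -> finsupp (fun j => f j \ot g (n - j)).
Proof.
move=> [N fN] [M gM]; apply: (@finsupp_int _ _ N (n - M)) => j nz.
have /fN ? : f j != 0 by apply: contraNneq nz => ->; rewrite tpure0l.
have /gM ? : g (n - j) != 0 by apply: contraNneq nz => ->; rewrite tpure0r.
by lia.
Qed.

Lemma series_tensor_bilinear (U U' V V' W W' : lmodType F)
    (Y : U -> V -> int -> W) (Y' : U' -> V' -> int -> W') u a n :
  (forall n, bilinear_map (fun v w => Y v w n)) ->
  (forall n, bilinear_map (fun v w => Y' v w n)) ->
  (forall u v, laurent1 (Y u v)) -> (forall u v, laurent1 (Y' u v)) ->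
  bilinear_map (fun v b => series_tensor (Y u v) (Y' a b) n).
Proof.
move=> bY bY' lY lY'; have [tl tr] := tpure_bilinear W W'.
split=> [b|v].
  apply: (fsum_linear (f := fun j v => Y u v j \ot Y' a b (n - j))) => [j|v].
    by move=> c x y; rewrite (bY j).2 tl.
  exact: series_tensor_finsupp.
apply: (fsum_linear (f := fun j b => Y u v j \ot Y' a b (n - j))) => [j|b].
  by move=> c x y; rewrite (bY' _).2 tr.
exact: series_tensor_finsupp.
Qed.

End Products.

(** * The axioms for the deformed operator *)

Section Deformation.
Variables (F : numFieldType) (H : lmodType F) (YH : H -> H -> int -> H).
Variables (vacH : H) (Delta : H -> tensor H H) (eps : H -> F^o).
Variables (V : lmodType F) (Y : V -> V -> int -> V) (vac : V).
Variables (YVH : H -> V -> int -> V) (rho : V -> tensor V H).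
Hypothesis HH : is_nv_bialgebra YH vacH Delta eps.
Hypothesis Hcc : is_cocommutative Delta.
Hypothesis HV : is_nva Y vac.
Hypothesis HM : is_module_nva YH vacH Delta eps Y vac YVH.
Hypothesis HC : is_comodule_nva YH vacH Delta eps Y vac rho.
Hypothesis Hcomp : are_compatible YVH rho.

Notation YD := (deformed_Y Y YVH rho).
Notation spanned1 := (spanned (fun c : int -> F => laurent1 (c : _ -> F^o))).
Notation spanned2 := (spanned (fun c : int * int -> F => laurent2 (c : _ ->
  F^o))).

Let vY : is_vertex_map Y. Proof. by case: HV. Qed.
Let vYH : is_vertex_map YH. Proof. by case: HH => -[]. Qed.
Let vYVH : is_vertex_map YVH. Proof. by case: HM => _ []. Qed.
Let rho_lin : linear rho. Proof. by case: HC => _ []. Qed.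
Let tYVH h v : in_tensor_laurent (YVH h v). Proof. by case: HM. Qed.
Let sYVH h v : spanned1 (YVH h v).
Proof. exact: spanned_in_tensor_laurent. Qed.

Lemma apply_bilinear w n :
  bilinear_map (fun a h => apply_series Y a (YVH h w) n).
Proof.
split=> [h|a].
  apply: (fsum_linear (f := fun j a => Y a (YVH h w j) (n - j))) => [j|a].
    exact: vertex_linl.
  exact: apply_finsupp.
apply: (fsum_linear (f := fun j h => Y a (YVH h w j) (n - j))) => [j|h].
  by move=> c h h'; rewrite (vertexDl vYVH) (vertexZl vYVH) (vertexDr vY)
    (vertexZr vY).
exact: apply_finsupp.
Qed.

Lemma apply_linear a h n : linear (fun w => apply_series Y a (YVH h w) n).
Proof.
apply: (fsum_linear (f := fun j w => Y a (YVH h w j) (n - j))) => [j|w].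
  by move=> c w w'; rewrite (vertexDr vYVH) (vertexZr vYVH) (vertexDr vY)
    (vertexZr vY).
exact: apply_finsupp.
Qed.

Lemma apply_laurent1 a f : spanned1 f -> laurent1 (apply_series Y a f).
Proof.
move=> /(laurent2_apply a vY)[N YN]; exists (N + N) => n /fsum_neq0[j].
by move=> /(YN (j, n - j).1 (j, n - j).2)[/= ? ?]; lia.
Qed.

Lemma laurent1_sum (W : zmodType) (I : Type) (r : seq I) (f : I -> int -> W) :
  (forall i, laurent1 (f i)) -> laurent1 (fun n => \sum_(i <- r) f i n).
Proof.
move=> lf; elim: r => [|i r [N IH]].
  by exists 0 => n; rewrite big_nil eqxx.
have [M fM] := lf i; exists (- (`|N| + `|M|)) => n; rewrite big_cons.
have [->|/fM ? _] := eqVneq (f i n) 0; last by lia.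
by rewrite add0r => /IH ?; lia.
Qed.

Lemma deformed_vertex_map : is_vertex_map YD.
Proof.
split=> [n|v w].
  split=> [w|v].
    move=> c a b; rewrite /deformed_Y rho_lin.
    exact: (tsum_linear (apply_bilinear w n)).
  by apply: sum_linear => p; apply: apply_linear.
apply/in_laurentP.
by apply: laurent1_sum => p; apply: apply_laurent1.
Qed.

Lemma rho_vac : rho vac = vac \ot vacH.
Proof. by case: HC => _ []. Qed.

Lemma apply_vac f n : apply_series Y vac f n = f n.
Proof.
have Yvac v m : Y vac v m = const_series v m by case: HV.
rewrite /apply_series -/(fsum _) (@fsum_one _ _ n).
  by rewrite Yvac /const_series subrr eqxx.
by move=> j jn; rewrite Yvac /const_series subr_eq0 eq_sym (negPf jn).
Qed.

Lemma deformed_vacl v n : YD vac v n = const_series v n.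
Proof.
rewrite /deformed_Y rho_vac (tsum_pure (apply_bilinear v n)) apply_vac.
by case: HM => _ [_ ->].
Qed.

(** The action of [h] on the vacuum is the scalar [eps h], which moves into the first argument of
    [Y]; the counit identity for [rho] then recovers [v]. *)
Lemma deformed_vacr v n : YD v vac n = Y v vac n.
Proof.
have E a h : apply_series Y a (YVH h vac) n = Y (eps h *: a) vac n.
  have YVHvac m : YVH h vac m = const_series (eps h *: vac) m by case: HM.
  rewrite /apply_series -/(fsum _) (@fsum_one _ _ 0).
    by rewrite YVHvac /const_series eqxx subr0 (vertexZr vY) (vertexZl vY).
  by move=> j j0; rewrite YVHvac /const_series (negPf j0) (vertex0r vY).
rewrite /deformed_Y /tsum (eq_bigr _ (fun p _ => E p.1 p.2)).
rewrite -(lin_sum (vertex_linl vac n vY)); congr (Y _ _ _).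
by case: HC => _ _ _ /(_ v).
Qed.

(** The module axiom gives this after multiplication by [(x1 - x2)^k]. As the product is itself
    bounded below in both variables, that factor becomes [x0^k] and cancels. *)
Lemma module_expand_add h h' w m n :
  expand_add (fun g => YVH h (YVH h' w g.2) g.1) (m, n) = YVH (YH h h' m) w n.
Proof.
have [_ [_ _ aYVH] _ _ _] := HM.
have [k /(_ w) kP] := aYVH h h'.
have [lG AB] := iffRL (associatedP k (iterate YVH h h' w)
  (fun g => YVH (YH h h' g.1) w g.2)) kP.
have lau2G : laurent2 (fun g => YVH h (YVH h' w g.2) g.1).
  by apply: spanned_laurent2; apply: spanned_iterate.
have := AB (m + k%:Z) n; rewrite /= addrK => <-.
by rewrite [RHS]expand_add_delta_conv// -[in LHS](addrK k%:Z m) -[in LHS](subr0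
  n).
Qed.

Lemma coassoc_sum (W : lmodType F) (B : V -> H -> H -> W) v :
  (forall h h', linear (fun u => B u h h')) -> (forall u, bilinear_map (B u)) ->
  tsum (rho v) (fun u h => tsum (rho u) (fun u1 u2 => B u1 u2 h)) =
  tsum (rho v) (fun u h => tsum (Delta h) (fun h1 h2 => B u h1 h2)).
Proof.
move=> lB bB.
have bT : bilinear_map (fun u (y : tensor H H) => tsum y (B u)).
  by split=> [y|u]; [apply: tsum_linear_fun|apply: tsum_linear].
have bT' : bilinear_map (fun (y : tensor V H) h => tsum y (fun u1 u2 =>
  B u1 u2 h)).
  split=> [h|y].
    apply: tsum_linear; split=> [h'|u]; first exact: lB.
    by move=> c a b; rewrite (bB u).1.
  by apply: sum_linear => p; rewrite (_ : (fun=> _) = B p.1 p.2)//;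
    apply: (bB _).2.
have [_ _ coassoc _] := HC.
have := congr1 (fun z => tsum z (fun u y => tsum y (B u))) (coassoc v).
rewrite tsum_tassoc// tsum_tmap// tsum_tmap//.
Qed.

Lemma cocomm_sum (W : lmodType F) (B : H -> H -> W) h : bilinear_map B ->
  tsum (Delta h) (fun x y => B y x) = tsum (Delta h) B.
Proof. by move=> bB; rewrite -[in RHS](Hcc h) tsum_tswap. Qed.


(* The coefficient of [x^n] in [Y(u, x) YVH(h, x) v (x) YH(h', x) b]. *)
Definition smash_term u h h' v b (n : int) (x : int * int) : tensor V H :=
  Y u (YVH h v x.1) x.2 \ot YH h' b (n - x.1 - x.2).

Lemma smash_term_finsupp u h h' v b n : finsupp (smash_term u h h' v b n).
Proof.
have [N YN] := laurent2_apply u vY (sYVH h v).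
have [M gM] := vertex_laurent1 h' b vYH.
apply: (@finsupp_box _ _ N (n - N - M) N (n - N - M)) => i j nz.
have /YN /= [? ?] : Y u (YVH h v i) j != 0.
  by apply: contraNneq nz => E; rewrite /smash_term /= E tpure0l.
have /gM ? : YH h' b (n - i - j) != 0.
  by apply: contraNneq nz => E; rewrite /smash_term /= E tpure0r.
by split; lia.
Qed.

Lemma smash_term_iter u h h' v b n :
  series_tensor (apply_series Y u (YVH h v)) (YH h' b) n =
  fsum (smash_term u h h' v b n).
Proof.
pose s (x : int * int) := (x.2, x.1 - x.2).
pose s' (x : int * int) := (x.2 + x.1, x.1).
have sK : cancel s s' by move=> [i j]; rewrite /s /s' /= subrK.
have s'K : cancel s' s by move=> [i j]; rewrite /s /s' /= addrK.
rewrite (fsum_reindex _ sK s'K) fsum_pair; last exact: (finsupp_comp sK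
  (smash_term_finsupp _ _ _ _ _ _)).
have [tl _] := tpure_bilinear V H.
apply: eq_fsum => l; rewrite (fsum_lin (tl _)); last exact: apply_finsupp.
apply: eq_fsum => j; rewrite /smash_term /s /=; congr (_ \ot YH _ _ _).
by lia.
Qed.

Lemma smash_term_linear1 h h' v b n : linear (fun u =>
  fsum (smash_term u h h' v b n)).
Proof.
apply: (fsum_linear (f := fun x u => smash_term u h h' v b n x)) => [x|u].
  by move=> c u u'; rewrite /smash_term (vertex_linl _ _ vY) (tpure_bilinear V
    H).1.
exact: smash_term_finsupp.
Qed.

Lemma smash_term_linear2 u h' v b n : linear (fun h =>
  fsum (smash_term u h h' v b n)).
Proof.
apply: (fsum_linear (f := fun x h => smash_term u h h' v b n x)) => [x|h].
  move=> c h1 h2; rewrite /smash_term (vertex_linl _ _ vYVH) (vertex_linr _ _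
    vY).
  by rewrite (tpure_bilinear V H).1.
exact: smash_term_finsupp.
Qed.

Lemma smash_term_linear3 u h v b n : linear (fun h' =>
  fsum (smash_term u h h' v b n)).
Proof.
apply: (fsum_linear (f := fun x h' => smash_term u h h' v b n x)) => [x|h'].
  by move=> c h1 h2; rewrite /smash_term (vertex_linl _ _ vYH) (tpure_bilinear V
    H).2.
exact: smash_term_finsupp.
Qed.

(** Multiplicativity of [rho] splits the product, and compatibility lets [h] act on the [V]
    component of [rho v] only. *)
Lemma rho_apply a h v n :
  rho (apply_series Y a (YVH h v) n) =
  tsum (rho a) (fun u h' => tsum (rho v) (fun v1 b =>
    fsum (smash_term u h h' v1 b n))).
Proof.
have [_ [_ _ rhoY] _ _] := HC.
rewrite (fsum_lin rho_lin); last exact: apply_finsupp.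
have E j : rho (Y a (YVH h v j) (n - j)) =
    tsum (rho a) (fun u h' => tsum (rho v) (fun v1 b =>
      fsum (fun l => smash_term u h h' v1 b n (j, l)))).
  rewrite rhoY Hcomp /tensor_Y; apply: eq_bigr => p _.
  rewrite tsum_tmap//; apply: series_tensor_bilinear.
  - by case: vY.
  - by case: vYH.
  - by move=> *; apply: vertex_laurent1.
  - by move=> *; apply: vertex_laurent1.
rewrite (eq_fsum E) fsum_sum; last first.
  move=> p; apply: finsupp_sum => q.
  exact: finsupp_fsum (smash_term_finsupp _ _ _ _ _ _).
apply: eq_bigr => p _; rewrite fsum_sum; last first.
  by move=> q; apply: finsupp_fsum (smash_term_finsupp _ _ _ _ _ _).
by apply: eq_bigr => q _; rewrite -fsum_pair//; apply: smash_term_finsupp.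
Qed.

(** After coassociativity the second factor of [Delta] acts on [V] and the first multiplies in [H];
    the smash product has them the other way round, and cocommutativity exchanges them. *)
Lemma rho_deformed u v n : rho (YD u v n) = smash_Y YH Delta Y YVH (rho u) (rho
  v) n.
Proof.
rewrite /deformed_Y /tsum (lin_sum rho_lin).
transitivity (tsum (rho u) (fun u1 h => tsum (rho u1) (fun u2 h' =>
    tsum (rho v) (fun v1 b => fsum (smash_term u2 h h' v1 b n))))).
  by apply: eq_bigr => p _; rewrite rho_apply.
have bB u2 : bilinear_map (fun h' h =>
    tsum (rho v) (fun v1 b => fsum (smash_term u2 h h' v1 b n))).
  split=> [h|h']; apply: sum_linear => p.
    exact: smash_term_linear3.
  exact: smash_term_linear2.
rewrite (coassoc_sum (B := fun u2 h' h =>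
    tsum (rho v) (fun v1 b => fsum (smash_term u2 h h' v1 b n))))//; last first.
  by move=> h h'; apply: sum_linear => p; apply: smash_term_linear1.
apply: eq_bigr => p _; rewrite -cocomm_sum// /tsum exchange_big.
by do 2!apply: eq_bigr => ? _; rewrite smash_term_iter.
Qed.

(* This is finiteness of [prod_term vac], since [Y(1, x1)] is the identity. *)
Lemma prod_term_finsupp f G s q : spanned1 f -> spanned2 G ->
  finsupp (fun x : int * (int * int) =>
    Y (subst_sub f x.2.1 x.2.2) (G (s - x.2.1, x.1)) (q - x.1 - x.2.2)).
Proof.
have aY : weakly_associative Y Y by case: HV.
move=> sf sG; have [k kP] := prod_assoc_spanned vY aY vac sf.
have [/(_ (s, q)) pf _ _] := kP G sG.
pose h (x : int * (int * int)) : (int * int) * (int * int) :=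
  (x.2, (s - x.2.1, x.1)).
pose h' (x : (int * int) * (int * int)) : int * (int * int) := (x.2.2, x.1).
have hK : cancel h h' by move=> [t [i j]].
apply: (sub_finsupp _ (finsupp_comp hK pf)) => -[t [i j]].
rewrite /prod_term /h /= subrr subst_subE [q - j - t]addrAC.
by case: HV => _ -> _ _; rewrite /const_series eqxx.
Qed.

(** The deformed product arises as nested sums with [Y a] between the levels. Moving [Y a] inside
    needs finiteness of the inner sums, which is [prod_term_finsupp]; then all levels flatten into a
    single family. *)
Lemma prod_term_iter a f G p q : spanned1 f -> spanned2 G ->
  finsupp (fun s => Y a (fsum (fun t => fsum (fun ij : int * int =>
    Y (subst_sub f ij.1 ij.2) (G (s - ij.1, t)) (q - t - ij.2)))) (p - s)) /\
  fsum (fun s => Y a (fsum (fun t => fsum (fun ij : int * int =>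
    Y (subst_sub f ij.1 ij.2) (G (s - ij.1, t)) (q - t - ij.2)))) (p - s)) =
  fsum (prod_term Y a f G (p, q)).
Proof.
have aY : weakly_associative Y Y by case: HV.
move=> sf sG; have [k kP] := prod_assoc_spanned vY aY a sf.
have [/(_ (p, q)) pf _ _] := kP G sG.
pose h (x : int * (int * (int * int))) : (int * int) * (int * int) :=
  (x.2.2, (x.1 - x.2.2.1, x.2.1)).
pose h' (x : (int * int) * (int * int)) : int * (int * (int * int)) :=
  (x.2.1 + x.1.1, (x.2.2, x.1)).
have hK : cancel h h' by move=> [s [t [i j]]]; rewrite /h /h' /= subrK.
have h'K : cancel h' h by move=> [[i j] [r t]]; rewrite /h /h' /= addrK.
have hf := finsupp_comp hK pf.
have E s : Y a (fsum (fun t => fsum (fun ij : int * int =>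
    Y (subst_sub f ij.1 ij.2) (G (s - ij.1, t)) (q - t - ij.2)))) (p - s) =
    fsum (fun x => prod_term Y a f G (p, q) (h (s, x))).
  rewrite -(fsum_pair (prod_term_finsupp s q sf sG)).
  rewrite (fsum_lin (vertex_linr a _ vY)); last exact: prod_term_finsupp.
  apply: eq_fsum => -[t [i j]]; rewrite /prod_term /h /= subst_subE.
  by congr (Y _ (Y _ _ _) _); lia.
split; first by rewrite (funext E); apply: (finsupp_fsum hf).
by rewrite (eq_fsum E) (fsum_reindex _ hK h'K) fsum_pair.
Qed.

Lemma iter_term_iter a f G m n : spanned1 f -> spanned2 G ->
  fsum (fun l => fsum (fun r =>
    Y (apply_series Y a f l) (expand_add G (m - l, r)) (n - r))) =
  fsum (iter_term Y a f (expand_add G) (m, n)).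
Proof.
have aY : weakly_associative Y Y by case: HV.
move=> sf sG; have [k kP] := prod_assoc_spanned vY aY a sf.
have [_ /(_ (m, n)) jf _] := kP G sG.
pose h (x : (int * int) * (int * int)) : (int * int) * (int * int) :=
  ((x.2.1, x.2.2), (m - x.1.1, x.1.2)).
pose h' (x : (int * int) * (int * int)) : (int * int) * (int * int) :=
  ((m - x.2.1, x.2.2), (x.1.1, x.1.2)).
have mK l : m - (m - l) = l by rewrite opprB subrKC.
have hK : cancel h h' by move=> [[l r] [j z]]; rewrite /h /h' /= mK.
have h'K : cancel h' h by move=> [[j z] [i r]]; rewrite /h /h' /= mK.
have hf := finsupp_comp hK jf.
rewrite (fsum_reindex _ hK h'K) fsum_pair//.
rewrite fsum_pair; last by apply: (finsupp_fsum hf).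
apply: eq_fsum => l; apply: eq_fsum => r.
rewrite fsum_pair; last exact: (finsupp_slice (l, r) hf).
rewrite (fsum_lin (vertex_linl _ _ vY)); last exact: apply_finsupp.
(* The series [f(x0)] is free of [x2], so only exponent 0 contributes. *)
apply: eq_fsum => j; rewrite (@fsum_one _ _ 0).
  rewrite /iter_term /h /= ?eqxx subr0; congr (Y (Y _ _ _) _ _); lia.
move=> z z0; rewrite /iter_term /h /= (negPf z0) (vertex0r vY).
by rewrite (vertex0l vY).
Qed.

Lemma deformed_weakly_associative : weakly_associative YD YD.
Proof.
have aY : weakly_associative Y Y by case: HV.
have HMY : forall h u v p q, YVH h (Y u v q) p = tsum (Delta h) (fun h1 h2 =>
    fsum (fun ij : int * int => Y (subst_sub (YVH h1 u) ij.1 ij.2)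
      (YVH h2 v (p - ij.1)) (q - ij.2))) by case: HM.
move=> a b.
pose G (d r : H) w (g : int * int) := YVH d (YVH r w g.2) g.1.
have sG d r w : spanned2 (G d r w) by apply: spanned_iterate.
suff [k kP] : exists k, forall w, associated k (fun g =>
  iterate YD a b w g.1 g.2)
    (fun g => YD (YD a b g.1) w g.2).
  by exists k => w; exact: (iffLR (associatedP k (iterate YD a b w) (fun g =>
    YD (YD a b g.1) w g.2)) (kP w)).
(* The parameter of [associated_sum] is [w], which only enters through [G]; this makes [k]
   uniform. *)
have [k kP] : exists k, forall w, associated k
  (fun g => \sum_(p <- repr (rho a)) \sum_(r <- repr (rho b))
    \sum_(d <- repr (Delta p.2))
      fsum (prod_term Y p.1 (YVH d.1 r.1) (G d.2 r.2 w) g))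
  (fun g => \sum_(p <- repr (rho a)) \sum_(r <- repr (rho b))
    \sum_(d <- repr (Delta p.2))
      fsum (iter_term Y p.1 (YVH d.1 r.1) (expand_add (G d.2 r.2 w)) g)).
  apply: associated_sum => p; apply: associated_sum => r.
  apply: associated_sum => d.
  have [k kP] := prod_assoc_spanned vY aY p.1 (sYVH d.1 r.1).
  by exists k => w; have [] := kP _ (sG d.2 r.2 w).
exists k => w; move: (kP w); congr associated; apply: funext => -[m n] /=.
  rewrite /iterate [RHS]/deformed_Y /tsum; apply: eq_bigr => p _.
  (* Product side: the module axiom moves [p.2] past [Y r.1]. Its part [d.1] acts on [r.1], and
     [d.2] joins [YVH r.2 w] to form [G]. *)
  have E s : YVH p.2 (YD b w n) s = \sum_(r <- repr (rho b))
      \sum_(d <- repr (Delta p.2)) fsum (fun t => fsum (fun ij : int * int =>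
        Y (subst_sub (YVH d.1 r.1) ij.1 ij.2) (G d.2 r.2 w (s - ij.1, t)) (n - t
          - ij.2))).
    rewrite /deformed_Y /tsum (lin_sum (vertex_linr p.2 s vYVH)).
    apply: eq_bigr => r _; rewrite (fsum_lin (vertex_linr p.2 s vYVH));
      last exact: apply_finsupp.
    rewrite (eq_fsum (fun t => HMY _ _ _ _ _)) fsum_sum// => d.
    exact: finsupp_fsum (prod_term_finsupp s n (sYVH d.1 r.1) (sG d.2 r.2 w)).
  rewrite /apply_series -/(fsum _).
  have E' s : Y p.1 (YVH p.2 (YD b w n) s) (m - s) = \sum_(r <- repr (rho b))
      \sum_(d <- repr (Delta p.2)) Y p.1 (fsum (fun t =>
        fsum (fun ij : int * int =>
        Y (subst_sub (YVH d.1 r.1) ij.1 ij.2) (G d.2 r.2 w (s - ij.1, t)) (n - t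
          - ij.2))))
          (m - s).
    rewrite E (lin_sum (vertex_linr _ _ vY)); apply: eq_bigr => r _.
    by rewrite (lin_sum (vertex_linr _ _ vY)).
  have pti r d := prod_term_iter p.1 m n (sYVH (d : H * H).1 (r : V * H).1) (sG
    d.2 r.2 w).
  rewrite (eq_fsum E') fsum_sum => [|r]; last first.
    by apply: finsupp_sum => d; have [] := pti r d.
  apply: eq_bigr => r _; rewrite fsum_sum => [|d]; last by have [] := pti r d.
  by apply: eq_bigr => d _; have [_ ->] := pti r d.
(* Iterate side: [rho] of the deformed product is the smash product, whose [H] components
   [YH d.2 r.2] act on [w]; by [module_expand_add] this action is the expansion of [G] at
   [x1 = x2 + x0]. *)
have bD := apply_bilinear w n; have lD := tsum_linear bD.
rewrite [RHS]/deformed_Y rho_deformed.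
rewrite [smash_Y _ _ _ _ _ _ _](_ : _ = \sum_(p <- repr (rho a))
  \sum_(r <- repr (rho b)) \sum_(d <- repr (Delta p.2))
    series_tensor (apply_series Y p.1 (YVH d.1 r.1)) (YH d.2 r.2) m)//.
rewrite (lin_sum lD); apply: eq_bigr => p _.
rewrite (lin_sum lD); apply: eq_bigr => r _.
rewrite (lin_sum lD); apply: eq_bigr => d _.
rewrite -(iter_term_iter _ _ _ (sYVH d.1 r.1) (sG d.2 r.2 w)).
rewrite (fsum_lin lD); last first.
  apply: series_tensor_finsupp; first exact: apply_laurent1.
  exact: vertex_laurent1.
apply: eq_fsum => l; rewrite tsum_pure//.
by apply: eq_fsum => t; rewrite module_expand_add.
Qed.

Lemma deformed_nva : is_nva YD vac /\
  is_nva_hom YD vac (smash_Y YH Delta Y YVH) (vac \ot vacH) rho.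
Proof.
split; split.
- exact: deformed_vertex_map.
- exact: deformed_vacl.
- move=> v; have [_ _ /(_ v)[Yv0 Yv] _] := HV.
  by split=> [n n0|]; rewrite deformed_vacr// Yv0.
- exact: deformed_weakly_associative.
- exact: rho_lin.
- exact: rho_vac.
- exact: rho_deformed.
Qed.

End Deformation.

Theorem theorem2p25 (R : realType)
    (H : lmodType R[i]) (YH : H -> H -> int -> H) (vacH : H)
    (Delta : H -> tensor H H) (eps : H -> R[i]^o)
    (V : lmodType R[i]) (Y : V -> V -> int -> V) (vac : V)
    (YVH : H -> V -> int -> V) (rho : V -> tensor V H) :
  is_nv_bialgebra YH vacH Delta eps ->
  is_cocommutative Delta ->
  is_nva Y vac ->
  is_module_nva YH vacH Delta eps Y vac YVH ->
  is_comodule_nva YH vacH Delta eps Y vac rho ->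
  are_compatible YVH rho ->
  is_nva (deformed_Y Y YVH rho) vac /\
  is_nva_hom (deformed_Y Y YVH rho) vac
    (smash_Y YH Delta Y YVH) (vac \ot vacH) rho.
Proof. by move=> *; apply: (@deformed_nva _ H YH vacH Delta eps). Qed.
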